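(* Let $\Sigma$ be a finite subset of $\mathbb N^*$ of cardinality $|\Sigma|<q$. Then there is an isomorphism of graded $\mathcal Z_\emptyset(K)$-modules $\mathcal F_\Sigma:\mathcal Z_\Sigma(K)\to\mathcal L_\Sigma(K)$, where $\mathcal F_\Sigma$ is the map $f\mapsto\sum_{\underline i}f_{\underline i}\,\underline X_\Sigma^{q^{\underline i}}$ defined in the context.
   Context: Notation. $p$ is a prime, $q=p^e$ with $e\ge1$; $\mathbb N=\mathbb Z_{\ge0}$, $\mathbb N^*=\mathbb Z_{>0}$; $A=\mathbb F_q[\theta]$, $K=\mathbb F_q(\theta)$, $K_\infty=\mathbb F_q((1/\theta))$, $\mathbb C_\infty$ is the completion of an algebraic closure of $K_\infty$, with absolute value $|\cdot|$; $A^+$ is the set of monic polynomials of $A$. For $a\in A$, $a(t)\in\mathbb F_q[t]$ is obtained by replacing $\theta$ by $t$. $D_i=\prod_{j=0}^{i-1}(\theta^{q^i}-\theta^{q^j})$, $l_i=\prod_{j=1}^{i}(\theta-\theta^{q^j})$, $D_0=l_0=1$. Empty sums are $0$, empty products are $1$. Let $\mathfrak S$ be the set of maps $\Sigma:\mathbb N^*\to\mathbb N$ with finite support, with product $(\Sigma\cdot\Sigma')(x)=\Sigma(x)+\Sigma'(x)$ and neutral element $\emptyset$ (the zero map). Finite subsets of $\mathbb N^*$ are identified with their characteristic functions. An admissible composition array of $\binom{\Sigma}{n}$ is a matrix $\mathcal C=\begin{pmatrix}\Sigma_1&\cdots&\Sigma_r\\ n_1&\cdots&n_r\end{pmatrix}$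 with $r\ge1$, $\Sigma_i\in\mathfrak S$, $n_i\in\mathbb N^*$, $\Sigma_1\cdots\Sigma_r=\Sigma$, $\sum_i n_i=n$ ($n$ is the weight, $\Sigma$ the type); in addition $\binom{\emptyset}{0}$ is admissible, of depth $0$. Multiple zeta values: $\zeta_A(\mathcal C)=\sum_{a_1,\dots,a_r\in A^+,\ |a_1|>\cdots>|a_r|}\frac{\chi_{\Sigma_1}(a_1)\cdots\chi_{\Sigma_r}(a_r)}{a_1^{n_1}\cdots a_r^{n_r}}$ with $\chi_\Sigma(a)=\prod_i a(t_i)^{\Sigma(i)}$, and $\zeta_A\binom{\emptyset}{0}=1$. These are entire functions of the variables $t_i$, $i$ in the support of $\Sigma$; $\mathbb E_\Sigma$ denotes the $\mathbb C_\infty$-algebra of entire functions $\mathbb C_\infty^{\Sigma}\to\mathbb C_\infty$. $\mathcal Z_{n,\Sigma}(K)$ is the $K$-span of the $\zeta_A(\mathcal C)$ with $\mathcal C$ an admissible composition array of $\binom{\Sigma}{n}$, and $\mathcal Z_\Sigma(K)=\sum_{n\ge0}\mathcal Z_{n,\Sigma}(K)$, graded by $n$. $\mathcal Z_\emptyset(K)$ is the graded $K$-algebra generated by Thakur's multiple zeta values; it acts on $\mathcal Z_\Sigma(K)$ by multiplication. Multiple polylogarithms: with $S_d(n)=\sum_{a\in A^+,\deg a=d}a^{-n}$, $\lambda_A(\mathcal C)=\sum_{d_1>\cdots>d_r\ge0}S_{d_1}(n_1)\cdots S_{d_r}(n_r)\prod_{i\in\mathbb N^*}X_i^{\sum_{j=1}^r\Sigma_j(i)q^{d_j}}$,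 and $\lambda_A\binom{\emptyset}{0}=1$. $\mathcal L_{n,\Sigma}(K)$ is the $K$-span of the $\lambda_A(\mathcal C)$ with $\mathcal C$ admissible of $\binom{\Sigma}{n}$, and $\mathcal L_\Sigma(K)=\sum_{n\ge0}\mathcal L_{n,\Sigma}(K)$, graded by $n$; $\mathcal Z_\emptyset(K)=\mathcal L_\emptyset(K)$ acts on it by multiplication. Map $\mathcal F_\Sigma$ (for $\Sigma$ a finite subset of $\mathbb N^*$): for $\underline i=(i_j)_{j\in\Sigma}\in\mathbb N^\Sigma$ put $\underline\theta^{q^{\underline i}}=(\theta^{q^{i_j}})_{j\in\Sigma}$ and $\underline X_\Sigma^{q^{\underline i}}=\prod_{j\in\Sigma}X_j^{q^{i_j}}$. For $f\in\mathbb E_\Sigma$ set $f_{\underline i}=\sum_{\underline j\le\underline i}f(\underline\theta^{q^{\underline j}})\prod_{k\in\Sigma}D_{j_k}^{-1}l_{i_k-j_k}^{-q^{j_k}}$ (componentwise order) and $\mathcal F_\Sigma(f)=\sum_{\underline i\in\mathbb N^\Sigma}f_{\underline i}\,\underline X_\Sigma^{q^{\underline i}}\in\mathbb C_\infty[[X_j:j\in\Sigma]]$. *)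

(* Defs.v *)
From HB Require Import structures.
From mathcomp Require Import all_boot all_order all_algebra.
From mathcomp Require Import finmap multiset.
From mathcomp Require Import all_classical all_reals all_analysis.

Set Implicit Arguments.
Unset Strict Implicit.
Unset Printing Implicit Defensive.

Import Order.TTheory GRing.Theory Num.Theory.
Import numFieldNormedType.Exports.

Local Open Scope classical_set_scope.
Local Open Scope mset_scope.
Local Open Scope ring_scope.

Section Valued.
Context (R : realType) (C : fieldType) (v : C -> R).

Definition vcvg (u : nat -> C) (l : C) : Prop :=
  (fun n => v (u n - l)) @ \oo --> (0 : R).

Definition vcauchy (u : nat -> C) : Prop :=
  forall e : R, 0 < e ->
    exists N : nat, forall m n : nat, (N <= m)%N -> (N <= n)%N ->
      v (u m - u n) < e.

(* 0 when the sequence diverges *)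
Definition vlim (u : nat -> C) : C := xget 0 [set l | vcvg u l].

Definition vclosure (A : set C) : set C :=
  [set x | forall e : R, 0 < e -> exists2 a, A a & v (x - a) < e].

Definition alg_over (A : set C) : set C :=
  [set x | exists p : {poly C}, [/\ p != 0, forall i, A p`_i & root p x]].

End Valued.

(* C together with this structure is a completion of an algebraic closure of
   K_oo = F((1/theta)), where K = {fraction {poly F}} = F(theta). In the complete
   field C, K_oo is the closure of K, and its algebraic closure consists of the
   elements of C that are algebraic over K_oo. The absolute value is normalised
   by |theta| = #|F|. *)
Record Cinfty (R : realType) (F : finFieldType) (C : fieldType) := MkCinfty {
  emb : {rmorphism {fraction {poly F}} -> C};
  vabs : C -> R;
  vabs_ge0 : forall x, 0 <= vabs x;
  vabs_eq0 : forall x, vabs x = 0 -> x = 0;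
  vabsM : forall x y, vabs (x * y) = vabs x * vabs y;
  vabs_ultra : forall x y, vabs (x + y) <= Num.max (vabs x) (vabs y);
  vabs_poly : forall a : {poly F}, a != 0 ->
    vabs (emb (tofrac a)) = #|F|%:R ^+ (size a).-1;
  vcomplete : forall u : nat -> C, vcauchy vabs u -> exists l, vcvg vabs u l;
  Kbar_closed : forall p : {poly C},
    (forall i, alg_over (vclosure vabs (range emb)) p`_i) -> (1 < size p)%N ->
    exists2 x, alg_over (vclosure vabs (range emb)) x & root p x;
  Kbar_dense : vclosure vabs (alg_over (vclosure vabs (range emb))) = setT
}.

(* N^* *)
Definition npos : Type := {n : nat | (0 < n)%N}.

(* The array with columns (Sigma_1, n_1), ..., (Sigma_r, n_r); the monoid of
   finitely supported maps N^* -> N is {mset npos}. *)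
Definition array : Type := seq ({mset npos} * npos).

(* For the empty array (depth 0) the two equations force Sigma = 0 and n = 0. *)
Definition admissible (Sg : {mset npos}) (n : nat) (c : array) : Prop :=
  (forall x : npos, (\sum_(b <- c) b.1 x)%N = Sg x) /\
  (\sum_(b <- c) val b.2)%N = n.

Definition indicator (V : {fset npos}) : {mset npos} := seq_mset V.

Section Functions.
Context (R : realType) (F : finFieldType) (C : fieldType) (CI : Cinfty R F C).

Notation q := #|F|.
Notation K := {fraction {poly F}}.

Definition evt (a : {poly F}) : C := emb CI (tofrac a).
Definition theta : C := evt 'X.

(* a(t) *)
Definition evat (a : {poly F}) (t : C) : C :=
  (map_poly (fun x : F => evt x%:P) a).[t].

Definition carlitzD (i : nat) : C :=
  \prod_(0 <= j < i) (theta ^+ (q ^ i) - theta ^+ (q ^ j)).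

Definition carlitzl (i : nat) : C :=
  \prod_(1 <= j < i.+1) (theta - theta ^+ (q ^ j)).

Section Variables.
Context (V : {fset npos}).

(* functions C^V -> C and power series C[[X_j : j in V]], the latter given by
   their coefficients; C^o makes both of them C-modules pointwise *)
Definition functions : Type := {ffun V -> C} -> C^o.
Definition pseries : Type := {ffun V -> nat} -> C^o.

Definition chi (Sg : {mset npos}) (a : {poly F}) (t : {ffun V -> C}) : C :=
  \prod_(i : V) evat a (t i) ^+ Sg (val i).

(* restriction of the sum to |a_1| < q ^ D ({poly_D F} : degree < D) *)
Definition zeta_trunc (c : array) (t : {ffun V -> C}) (D : nat) : C :=
  \sum_(a : {ffun 'I_(size c) -> {poly_D F}} |
       [forall i, polyn (a i) \is monic] &&
       [forall i : 'I_(size c), forall j : 'I_(size c), (i < j)%N ==>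
          (vabs CI (evt (a j)) < vabs CI (evt (a i)))])
    \prod_(i < size c)
      (chi (tnth (in_tuple c) i).1 (a i) t
         / evt (a i) ^+ val (tnth (in_tuple c) i).2).

(* As an entire function of t the multiple zeta value is summed by degrees; for
   |t_i| <= 1 the multiple series converges unconditionally. *)
Definition zeta (c : array) : functions :=
  fun t => vlim (vabs CI) (zeta_trunc c t).

Definition power_sum (d n : nat) : C :=
  \sum_(a : {poly_d.+1 F} | (polyn a \is monic) && (size a == d.+1))
    (evt a ^+ n)^-1.

(* coefficient of X^m in the sum restricted to d_1 < D *)
Definition lambda_trunc (c : array) (m : {ffun V -> nat}) (D : nat) : C :=
  \sum_(d : {ffun 'I_(size c) -> 'I_D} |
       [forall i : 'I_(size c), forall j : 'I_(size c),
          (i < j)%N ==> (d j < d i)%N] &&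
       [forall x : V, m x ==
          (\sum_(k < size c) (tnth (in_tuple c) k).1 (val x) * q ^ d k)%N])
    \prod_(k < size c) power_sum (d k) (val (tnth (in_tuple c) k).2).

Definition lambda (c : array) : pseries :=
  fun m => vlim (vabs CI) (lambda_trunc c m).

Definition coefF (f : functions) (i : {ffun V -> nat}) : C :=
  \sum_(j : {ffun V -> 'I_(\max_(k : V) i k).+1} | [forall k, (j k <= i k)%N])
    f [ffun k => theta ^+ (q ^ j k)] *
    \prod_(k : V) ((carlitzD (j k))^-1
                   * (carlitzl (i k - j k) ^+ (q ^ j k))^-1).

(* the exponent m is q^i for at most one i, namely i_k = log_q m_k *)
Definition mapF (f : functions) : pseries :=
  fun m =>
    let i := [ffun k => trunc_log q (m k)] in
    if [forall k, m k == (q ^ i k)%N] then coefF f i else 0.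

End Variables.

Definition Kspan (M : lmodType C) (X : set M) : set M :=
  [set y | exists (N : nat) (k : 'I_N -> K) (x : 'I_N -> M),
     (forall i, X (x i)) /\ y = \sum_(i < N) emb CI (k i) *: x i].

Definition Zn (V : {fset npos}) (n : nat) : set (functions V) :=
  Kspan [set f | exists2 c, admissible (indicator V) n c & f = zeta (V := V) c].

Definition Ln (V : {fset npos}) (n : nat) : set (pseries V) :=
  Kspan [set f | exists2 c, admissible (indicator V) n c & f = lambda (V := V) c].

(* weight n part of Z_emptyset(K), whose elements, functions on the one-point
   space C^emptyset, are identified with their value *)
Definition Zempty (n : nat) : set C :=
  [set z | exists2 f, Zn (V := fset0) n f & z = f [ffun=> 0]].

End Functions.

Section GradedModules.
Context (C : fieldType).

(* sum of the homogeneous components *)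
Definition gsum (M : zmodType) (Mn : nat -> set M) : set M :=
  [set y | exists (N : nat) (x : nat -> M),
     (forall n, Mn n (x n)) /\ y = \sum_(n < N) x n].

Definition graded_module (An : nat -> set C) (M : lmodType C)
    (Mn : nat -> set M) : Prop :=
  [/\ forall n, Mn n 0,
      forall n x y, Mn n x -> Mn n y -> Mn n (x - y) &
      forall m n a x, An m a -> Mn n x -> Mn (m + n)%N (a *: x)].

Definition graded_iso (An : nat -> set C) (M N : lmodType C)
    (Mn : nat -> set M) (Nn : nat -> set N) (phi : M -> N) : Prop :=
  [/\ set_bij (gsum Mn) (gsum Nn) phi,
      forall x y, gsum Mn x -> gsum Mn y -> phi (x + y) = phi x + phi y,
      forall a x, gsum An a -> gsum Mn x -> phi (a *: x) = a *: phi x &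
      forall n, phi @` Mn n = Nn n].

End GradedModules.

(* Main.v *)
Require Import Defs.
From HB Require Import structures.
From mathcomp Require Import all_boot all_order all_algebra.
From mathcomp Require Import finmap multiset.
From mathcomp Require Import all_classical all_reals all_analysis.
From mathcomp Require Import qpoly finfield.
From mathcomp Require Import ring lra zify.

(** Write [b_d(t)] for the Newton polynomial [newton d t], the product of the
    [t - theta ^ (q ^ k)] for [k < d], and [S_d(n)] for the power sums
    [power_sum d n]. For a polynomial [a] in [F_q [theta]], the value of [a(t)] at
    [theta ^ (q ^ j)] is [a ^ (q ^ j)]. Hence Newton interpolation of [a(t)] at
    these nodes reads [a(t) = sum_i E_i(a) b_i(t)], where the Carlitz polynomial
    [E_i] vanishes at the [a] of degree less than [i] and takes the value [1] at the
    monic [a] of degree [i] ([evat_expand]). The coefficients of the map [F_Sigma]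
    are divided differences at the same nodes: it sends [b_i(t)] to
    [X ^ (q ^ i)], variable by variable.

    Consider, for weights [w k d] indexed by the variables [k] and the degrees [d],
    the nested sums built from the terms [S_d(n)] times the product of the [w k d]
    for [k] in [I] ([weight_term]). With the weights [X_k ^ (q ^ d)] they are the
    multiple polylogarithms, whose coefficients are obtained from delta weights.
    With the weights [b_d(t_k)] they span, over [K], the same functions as the
    multiple zeta values of the same type and weight. Indeed, replacing each [a(t_k)]
    in a sum over the monic [a] of degree [d] by its Newton expansion yields the
    weighted term plus terms which involve [S_d(n - q ^ j)] and the coefficients of
    the [E_i] ([zeta_term_rec]). The sums in which [a] has a nonnegative exponent
    vanish by Lagrange interpolation; this is where the number of variables has to be
    less than [q]. The coefficients of [E_i] are themselves nested sums
    ([lagrange_wt_rec], [nested_lagrange_wt]), and products of nested sums are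
    nested sums by the quasi-shuffle product ([nestedM]), in which the terms of equal
    degrees are treated by partial fractions ([zeta_termM]). The relation is triangular with
    respect to the weight, so that it can be used in both directions
    ([znested_newton], [wnested_newton]).

    So [F_Sigma] replaces the weights [b_d(t_k)] by [X_k ^ (q ^ d)] in a fixed
    combination of weighted sums ([represents_coefF]), and therefore maps the span
    of the multiple zeta values onto that of the multiple polylogarithms. Everything
    converges because [|S_d(n)| <= 1 / |l_d|], and [1 / |l_d|] decreases faster than
    the product of less than [q] polynomials [b_d(t_k)] can grow
    ([newton_bound_ell]). The same estimate gives injectivity: if all the
    coefficients vanish, those of the truncated Newton expansion of [f] at degree
    [D] are bounded by a multiple of [1 / |l_D|], so that [f(t) = 0]
    ([newton_limit0]). *)

Set Implicit Arguments.
Unset Strict Implicit.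
Unset Printing Implicit Defensive.

Import Order.TTheory GRing.Theory Num.Theory.
Import numFieldNormedType.Exports.

Local Open Scope ring_scope.

(** * Lagrange interpolation and Carlitz polynomials *)

(** The sum is the top coefficient of the Lagrange interpolation polynomial of
    [p] at the [x i], and this polynomial is [p] itself. *)
Lemma lagrange_lead (K : fieldType) (I : finType) (x : I -> K) (p : {poly K}) :
  injective x -> (size p <= #|I|)%N ->
  \sum_i p.[x i] / \prod_(j | j != i) (x i - x j) = p`_(#|I|.-1).
Proof.
move=> x_inj sp.
pose w i := \prod_(j | j != i) (x i - x j).
pose L i : {poly K} := \prod_(j | j != i) ('X - (x j)%:P).
have w_neq0 i : w i != 0.
  apply/prodf_neq0 => j ji; rewrite subr_eq0; apply: contra ji => /eqP e.
  by apply/eqP/x_inj.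
have cardC (i : I) : #|[pred j | j != i]| = #|I|.-1.
  by rewrite -(cardC1 i); apply: eq_card.
have I_gt0 (i : I) : (0 < #|I|)%N by apply/card_gt0P; exists i.
have sL i : size (L i) = #|I|.
  rewrite /L size_prod => [|j _]; last by rewrite polyXsubC_eq0.
  under eq_bigr do rewrite size_XsubC.
  rewrite sum_nat_const cardC; have := I_gt0 i; lia.
have cL i : (L i)`_(#|I|.-1) = 1.
  have /monicP : L i \is monic by apply: monic_prod => j _; exact: monicXsubC.
  by rewrite lead_coefE sL.
pose P := \sum_i (p.[x i] / w i) *: L i.
suff Pp : P = p.
  rewrite -[in RHS]Pp /P coef_sum; apply: eq_bigr => i _.
  by rewrite coefZ cL mulr1.
have rt i : P.[x i] = p.[x i].
  rewrite /P horner_sum (bigD1 i) //= big1 ?addr0 => [|j ji].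
    rewrite hornerZ /L horner_prod.
    under eq_bigr do rewrite hornerXsubC.
    by rewrite divfK.
  rewrite hornerZ /L horner_prod (bigD1 i) 1?eq_sym //= hornerXsubC subrr.
  by rewrite mul0r mulr0.
apply/eqP; rewrite -subr_eq0; apply/eqP.
apply: (@roots_geq_poly_eq0 _ _ [seq x i | i in I]).
- apply/allP => y /mapP [i _ ->].
  by rewrite rootE hornerD hornerN rt subrr.
- by rewrite map_inj_uniq ?enum_uniq.
- rewrite size_image; apply: (leq_trans (size_polyD _ _)).
  rewrite size_polyN geq_max sp andbT.
  apply: (leq_trans (size_sum _ _ _)); apply/bigmax_leqP => i _.
  by rewrite (leq_trans (size_scale_leq _ _)) ?sL.
Qed.

Section Carlitz.
Context (R : realType) (F : finFieldType) (C : fieldType) (CI : Cinfty R F C).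

Local Notation q := #|F|.
Local Notation ev := (evt CI).
Local Notation vab := (vabs CI).

HB.instance Definition _ :=
  GRing.RMorphism.copy (evt CI) (emb CI \o @tofrac {poly F}).

Lemma q_gt1 : (1 < q)%N.
Proof. exact: finNzRing_gt1. Qed.

Lemma vabs0 : vab 0 = 0.
Proof.
apply/eqP; rewrite -[_ == 0]negbK; apply/negP => v0.
have v1 : vab 1 = 1.
  have := vabs_poly CI (oner_neq0 {poly F}).
  by rewrite -[emb CI _]/(ev 1) rmorph1 size_poly1 expr0.
have := vabsM CI 0 0; rewrite mul0r => /eqP; rewrite -subr_eq0.
have -> : vab 0 - vab 0 * vab 0 = vab 0 * (1 - vab 0) by ring.
rewrite mulf_eq0 (negPf v0) subr_eq0 /= => /eqP e.
(* [|0| = |0| |theta|] with [|0| = 1] would give [|theta| = 1]. *)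
have := vabsM CI 0 (ev 'X); rewrite mul0r -e mul1r vabs_poly ?polyX_eq0 //.
rewrite size_polyX expr1 => /eqP; rewrite eq_sym pnatr_eq1; have := q_gt1; lia.
Qed.

Lemma vabs_poly_ge1 a : a != 0 -> 1 <= vab (ev a).
Proof.
move=> a0; rewrite vabs_poly // exprn_ege1 //.
by rewrite ler1n (ltnW q_gt1).
Qed.

Lemma evt_eq0 a : (ev a == 0) = (a == 0).
Proof.
apply/eqP/eqP => [e|->]; last exact: rmorph0.
apply/eqP; case: eqVneq => // /vabs_poly_ge1; rewrite e vabs0.
by rewrite ler10.
Qed.

Lemma evt_inj : injective ev.
Proof.
move=> a b e; apply/eqP; rewrite -subr_eq0 -evt_eq0 rmorphB /= e.
by rewrite subrr.
Qed.

Lemma card_pnat_pchar j : [pchar C].-nat (q ^ j)%N.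
Proof.
have [p p_pr pF] := finPcharP F.
have pC : p \in [pchar C].
  rewrite inE p_pr /=; have := pcharf0 pF => /(congr1 (fun x => ev x%:P)).
  by rewrite polyC0 rmorph0 polyC_natr rmorph_nat => ->.
rewrite pnatX; apply/orP; left.
rewrite (eq_pnat _ (pcharf_eq pC)).
have := abelian.abelem_pgroup (abelian.fin_ring_pchar_abelem pF).
by rewrite /pgroup.pgroup cardsT.
Qed.

Lemma card_eq0 j : (0 < j)%N -> (q ^ j)%:R = 0 :> C.
Proof.
move=> j0; have [p p_pr pF] := finPcharP F.
have := card_pnat_pchar 1; rewrite expn1 => qC.
have pq : pdiv q \in \pi(q) by rewrite pi_pdiv q_gt1.
have /pcharf0 p0 := pnatPpi qC pq.
have /dvdnP [m ->] := dvdn_trans (pdiv_dvd q) (dvdn_exp j0 (dvdnn q)).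
by rewrite natrM p0 mulr0.
Qed.

Lemma exprDq j (x y : C) : (x + y) ^+ (q ^ j) = x ^+ (q ^ j) + y ^+ (q ^ j).
Proof. exact: exprDn_pchar (card_pnat_pchar j). Qed.

Lemma exprBq j (x y : C) : (x - y) ^+ (q ^ j) = x ^+ (q ^ j) - y ^+ (q ^ j).
Proof. by apply/eqP; rewrite eq_sym subr_eq -exprDq subrK. Qed.

Definition const_emb (x : F) : C := ev x%:P.

HB.instance Definition _ := GRing.RMorphism.copy const_emb (ev \o polyC).

Lemma evatE a t : evat CI a t = (map_poly const_emb a).[t].
Proof. by []. Qed.

Lemma evatD a b t : evat CI (a + b) t = evat CI a t + evat CI b t.
Proof. by rewrite !evatE rmorphD hornerD. Qed.

Lemma evatB a b t : evat CI (a - b) t = evat CI a t - evat CI b t.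
Proof. by rewrite !evatE rmorphB /= hornerD hornerN. Qed.

Lemma evatM a b t : evat CI (a * b) t = evat CI a t * evat CI b t.
Proof. by rewrite !evatE rmorphM hornerM. Qed.

Lemma evatC c t : evat CI c%:P t = ev c%:P.
Proof. by rewrite !evatE map_polyC hornerC. Qed.

Lemma evatX t : evat CI 'X t = t.
Proof. by rewrite !evatE map_polyX hornerX. Qed.

Definition node j : C := theta CI ^+ (q ^ j).

Lemma evat_node a j : evat CI a (node j) = ev a ^+ (q ^ j).
Proof.
have Fq (c : F) : c ^+ (q ^ j) = c.
  by elim: j => [|j IH]; rewrite ?expn0 ?expr1 // expnSr exprM IH expf_card.
elim/poly_ind: a => [|a c IH].
  rewrite evatE !rmorph0 horner0 expr0n expn_eq0.
  by rewrite -(negbK (q == 0%N)) -lt0n ltnW ?q_gt1.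
rewrite evatD evatM evatC evatX IH rmorphD rmorphM exprDq exprMn.
by rewrite -rmorphXn -polyC_exp Fq.
Qed.

Lemma node_inj : injective node.
Proof.
move=> i j; rewrite /node /theta -!rmorphXn => /evt_inj.
move=> /(congr1 (fun p : {poly F} => size p)).
by rewrite !size_polyXn => -[] /eqP; rewrite eqn_exp2l ?q_gt1 // => /eqP ->.
Qed.

(** The weight of the node number [j] in the divided difference at the nodes
    [theta ^ (q ^ k)], [k <= i]. It is also [1 / (D_j l_(i-j) ^ (q ^ j))], see
    [lagrange_wtE], so that the coefficients [f_i] of the map [F_Sigma] are divided
    differences. *)
Definition lagrange_wt i j : C :=
  if (j <= i)%N then
    (\prod_(k < i.+1 | k != j :> nat) (node j - node k))^-1
  else 0.

Definition newton d (t : C) : C := \prod_(k < d) (t - node k).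

Definition divdiff i (p : {poly C}) : C :=
  \sum_(j < i.+1) lagrange_wt i j * p.[node j].

Lemma divdiff_lead i (p : {poly C}) : (size p <= i.+1)%N -> divdiff i p = p`_i.
Proof.
move=> sp; have := @lagrange_lead C 'I_i.+1 (fun j => node j) p.
rewrite card_ord /= => <- //; last by move=> j k /node_inj /val_inj.
apply: eq_bigr => j _; rewrite /lagrange_wt -ltnS ltn_ord mulrC.
by congr (_ / _); apply: eq_bigl.
Qed.

Lemma newtonE d t : newton d t = (\prod_(k < d) ('X - (node k)%:P)).[t].
Proof. by rewrite horner_prod; apply: eq_bigr => k _; rewrite hornerXsubC. Qed.

Lemma newton_monic d : \prod_(k < d) ('X - (node k)%:P) \is monic.
Proof. by apply: monic_prod => k _; exact: monicXsubC. Qed.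

Lemma size_newton d : size (\prod_(k < d) ('X - (node k)%:P)) = d.+1.
Proof.
rewrite size_prod => [|k _]; last by rewrite polyXsubC_eq0.
under eq_bigr do rewrite size_XsubC.
by rewrite sum_nat_const card_ord; lia.
Qed.

Lemma newton_node d j : (j < d)%N -> newton d (node j) = 0.
Proof. by move=> jd; rewrite /newton (bigD1 (Ordinal jd)) //= subrr mul0r. Qed.

Lemma divdiff_newton i d :
  \sum_(j < i.+1) lagrange_wt i j * newton d (node j) = (d == i)%:R.
Proof.
case: (ltngtP d i) => [di|id|->].
- under eq_bigr do rewrite newtonE.
  rewrite -/(divdiff i _) divdiff_lead ?size_newton 1?ltnW //.
  by rewrite nth_default // size_newton.
- rewrite big1 // => j _; rewrite newton_node ?mulr0 //.
  by rewrite (leq_trans (ltn_ord j)).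
- under eq_bigr do rewrite newtonE.
  rewrite -/(divdiff i _) divdiff_lead ?size_newton //.
  by have /monicP := newton_monic i; rewrite lead_coefE size_newton.
Qed.

Lemma newton_expand d (p : {poly C}) t : (size p <= d)%N ->
  p.[t] = \sum_(i < d) divdiff i p * newton i t.
Proof.
elim: d p => [|d IH] p sp.
  by move: sp; rewrite leqn0 size_poly_eq0 => /eqP ->; rewrite horner0 big_ord0.
pose b : {poly C} := \prod_(k < d) ('X - (node k)%:P).
pose r := p - p`_d *: b.
have bd : b`_d = 1.
  by have /monicP := newton_monic d; rewrite lead_coefE size_newton.
have sr : (size r <= d)%N.
  apply/leq_sizeP => j; rewrite leq_eqVlt => /predU1P[<-|dj].
    by rewrite coefB coefZ bd mulr1 subrr.
  have bj : b`_j = 0 by rewrite nth_default // size_newton.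
  by rewrite coefB coefZ bj (nth_default _ (leq_trans sp dj)) mulr0 subrr.
have -> : p = r + p`_d *: b by rewrite subrK.
rewrite hornerD hornerZ -newtonE (IH _ sr) big_ord_recr /=.
have dE i : divdiff i (r + p`_d *: b) = divdiff i r + p`_d * (d == i)%:R.
  rewrite /divdiff -divdiff_newton mulr_sumr -big_split /=.
  apply: eq_bigr => j _; rewrite hornerD hornerZ -newtonE; ring.
congr (_ + _).
  apply: eq_bigr => i _; rewrite dE gtn_eqF ?mulr0 ?addr0 //.
have rd : divdiff d r = 0 by rewrite divdiff_lead ?(leq_trans sr) // nth_default.
by rewrite dE eqxx mulr1 rd add0r.
Qed.

(** The Carlitz polynomial [E_i], that is the product of the [z - b] for
    [deg b < i] divided by [D_i], in its additive form. *)
Definition carlitzE i (a : {poly F}) : C :=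
  \sum_(j < i.+1) lagrange_wt i j * ev a ^+ (q ^ j).

(** Raising [a] to the power [q ^ j] amounts to evaluating [a(t)] at the node of
    index [j]. *)
Lemma carlitzE_divdiff i a : carlitzE i a = divdiff i (map_poly const_emb a).
Proof.
by apply: eq_bigr => j _; rewrite -[X in _ = _ * X]evatE evat_node.
Qed.

Lemma carlitzE_small i (a : {poly F}) : (size a <= i)%N -> carlitzE i a = 0.
Proof.
move=> sa; rewrite carlitzE_divdiff divdiff_lead ?size_map_poly 1?ltnW //.
by rewrite nth_default // size_map_poly.
Qed.

Lemma carlitzE_monic i (a : {poly F}) : a \is monic -> size a = i.+1 ->
  carlitzE i a = 1.
Proof.
move=> /monicP; rewrite lead_coefE => la sa; rewrite sa /= in la.
rewrite carlitzE_divdiff divdiff_lead ?size_map_poly ?sa // coef_map la.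
exact: rmorph1.
Qed.

(** Newton's interpolation formula for [a(t)], whose divided differences are the
    [E_i(a)]. *)
Lemma evat_expand d (a : {poly F}) t : a \is monic -> size a = d.+1 ->
  evat CI a t = newton d t + \sum_(i < d) newton i t * carlitzE i a.
Proof.
move=> ma sa; rewrite evatE (@newton_expand d.+1) ?size_map_poly ?sa //.
rewrite big_ord_recr /= -carlitzE_divdiff carlitzE_monic // mul1r addrC.
by congr (_ + _); apply: eq_bigr => i _; rewrite -carlitzE_divdiff mulrC.
Qed.

Lemma lagrange_wtE i j : (j <= i)%N ->
  lagrange_wt i j = (carlitzD CI j)^-1 * (carlitzl CI (i - j) ^+ (q ^ j))^-1.
Proof.
move=> ji; rewrite /lagrange_wt ji -invfM; congr (_^-1).
rewrite -(big_mkord (fun k => k != j) (fun k => node j - node k)).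
rewrite (@big_cat_nat _ _ _ j) //=; last exact: leqW.
rewrite [X in _ * X]big_ltn_cond ?ltnS // eqxx /=.
congr (_ * _).
  rewrite /carlitzD big_mkcond /=.
  by apply: eq_big_nat => k /andP[_ kj]; rewrite ltn_eqF.
rewrite /carlitzl -prodrXl.
rewrite -{1}[j.+1]add1n -{1}(subnK ji) -addSn big_addn addnK big_mkcond.
apply: eq_big_nat => k /andP[k0 _]; rewrite exprBq -exprM -expnD.
have -> : (k + j == j)%N = false by lia.
by rewrite /= /node addnC.
Qed.

End Carlitz.

(** * Sums over monic polynomials *)

Lemma expf_div (K : fieldType) (x : K) m n : x != 0 ->
  x ^+ m / x ^+ n = if (m < n)%N then (x ^+ (n - m))^-1 else x ^+ (m - n).
Proof.
move=> x0; case: ltnP => mn.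
  by rewrite -{1}(subnKC (ltnW mn)) exprD invfM mulrA divff ?mul1r ?expf_neq0.
by rewrite -{1}(subnK mn) exprD mulfK ?expf_neq0.
Qed.

Section PolynomialSums.
Context (F : finFieldType).

Local Notation q := #|F|.

Lemma sum_npolyS (M : nmodType) d (f : {poly F} -> M) :
  \sum_(c : {poly_d.+1 F}) f (polyn c) =
  \sum_(x : F) \sum_(r : {poly_d F}) f (x *: 'X^d + polyn r).
Proof.
rewrite pair_big /=.
have sz (xr : F * {poly_d F}) : (size (xr.1 *: 'X^d + polyn xr.2)%R <= d.+1)%N.
  apply: (leq_trans (size_polyD _ _)); rewrite geq_max; apply/andP; split.
    by apply: (leq_trans (size_scale_leq _ _)); rewrite size_polyXn.
  exact: leq_trans (size_npoly _) (leqnSn d).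
pose h (xr : F * {poly_d F}) : {poly_d.+1 F} :=
  npolyp d.+1 (xr.1 *: 'X^d + polyn xr.2).
pose g (c : {poly_d.+1 F}) : F * {poly_d F} := (c`_d, npolyp d (polyn c)).
have hE xr : polyn (h xr) = xr.1 *: 'X^d + polyn xr.2 by rewrite npolypK.
have hg : cancel h g.
  move=> [x r]; rewrite /g hE /=; congr (_, _).
    by rewrite coefD coefZ coefXn eqxx mulr1 big_coef_npoly ?addr0.
  apply/npolyP => i; rewrite coef_npolyp coefD coefZ coefXn /=.
  case: ltnP => id; first by rewrite ltn_eqF // mulr0 add0r.
  by rewrite big_coef_npoly.
have gh : cancel g h.
  move=> c; apply/npolyP => i; rewrite hE coefD coefZ coefXn coef_npolyp /=.
  case: (ltngtP i d) => id; first by rewrite mulr0 add0r.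
    by rewrite mulr0 add0r big_coef_npoly.
  by rewrite id mulr1 addr0.
rewrite (reindex h) /=; last by exists g => ? _.
by apply: eq_bigr => xr _; rewrite hE.
Qed.

Definition msum (M : nmodType) d (f : {poly F} -> M) : M :=
  \sum_(r : {poly_d F}) f ('X^d + polyn r).

Lemma size_mon d (r : {poly_d F}) : size ('X^d + polyn r) = d.+1.
Proof. by rewrite size_polyDl size_polyXn // ltnS size_npoly. Qed.

Lemma mon_monic d (r : {poly_d F}) : 'X^d + polyn r \is monic.
Proof.
apply/monicP; rewrite lead_coefDl ?lead_coefXn // size_polyXn ltnS.
exact: size_npoly.
Qed.

Lemma eq_msum (M : nmodType) d (f g : {poly F} -> M) :
  (forall a, a \is monic -> size a = d.+1 -> f a = g a) ->
  msum d f = msum d g.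
Proof. by move=> fg; apply: eq_bigr => r _; rewrite fg ?mon_monic ?size_mon. Qed.

Lemma msumE (M : nmodType) D d (f : {poly F} -> M) : (d < D)%N ->
  \sum_(a : {poly_D F} | (polyn a \is monic) && (size a == d.+1)) f (polyn a)
  = msum d f.
Proof.
move=> dD.
pose h (r : {poly_d F}) : {poly_D F} := npolyp D ('X^d + polyn r).
pose g (c : {poly_D F}) : {poly_d F} := npolyp d (polyn c).
have hE r : polyn (h r) = 'X^d + polyn r by rewrite npolypK // size_mon.
rewrite (reindex_onto h g) => [|a /andP[/monicP ma /eqP sa]]; last first.
  apply/npolyP => i; rewrite hE coefD coefXn coef_npolyp.
  case: (ltngtP i d) => id; first by rewrite add0r.
    by rewrite add0r nth_default // sa.
  by move: ma; rewrite lead_coefE sa id addr0 => ->.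
rewrite /msum; apply: eq_big => [r|r _]; last by rewrite hE.
rewrite hE mon_monic size_mon eqxx /=; apply/eqP/npolyP => i.
rewrite coef_npolyp hE coefD coefXn.
case: ltnP => id; first by rewrite ltn_eqF // add0r.
by rewrite big_coef_npoly.
Qed.

Lemma sum_npoly_neq0 (M : nmodType) d (f : {poly F} -> M) :
  \sum_(c : {poly_d F} | polyn c != 0) f (polyn c) =
  \sum_(e < d) \sum_(x : F | x != 0) msum e (fun c => f (x *: c)).
Proof.
elim: d => [|d IH].
  rewrite big_ord0 big1 // => c; have := size_npoly c.
  by rewrite leqn0 size_poly_eq0 => ->.
rewrite big_mkcond (sum_npolyS d (fun c => if c != 0 then f c else 0)).
rewrite big_ord_recr /= (bigD1 0) //= -IH.
rewrite [X in X + _ = _](_ : _ = \sum_(c : {poly_d F} | polyn c != 0) f (polyn c)).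
  congr (_ + _); apply: eq_bigr => x x0.
  pose h (r : {poly_d F}) : {poly_d F} := x *: r.
  rewrite (reindex h) /=; last first.
    exists (fun r : {poly_d F} => x^-1 *: r) => r _.
      by rewrite /h scalerA mulVf // scale1r.
    by rewrite /h scalerA mulfV // scale1r.
  apply: eq_bigr => r _; rewrite /h /= -scalerDr scaler_eq0 (negPf x0) /=.
  by rewrite -size_poly_eq0 size_mon.
rewrite [RHS]big_mkcond; apply: eq_bigr => r _.
by rewrite scale0r add0r.
Qed.

End PolynomialSums.

Section PowerSums.
Context (R : realType) (F : finFieldType) (C : fieldType) (CI : Cinfty R F C).

Local Notation q := #|F|.
Local Notation ev := (evt CI).
Local Notation wt := (lagrange_wt CI).

Lemma ev_monic_neq0 a : a \is monic -> ev a != 0.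
Proof. by move=> /monic_neq0; rewrite evt_eq0. Qed.

Lemma power_sumE d n : power_sum CI d n = msum d (fun a => (ev a ^+ n)^-1).
Proof. by rewrite -(msumE _ (ltnSn d)). Qed.

Definition prod_neq0 d : C := \prod_(c : {poly_d F} | polyn c != 0) ev (polyn c).

(** Lagrange interpolation at the nodes [z + r], [deg r < d]: their differences
    are the polynomials of degree less than [d], so that all the denominators are
    equal to [prod_neq0 d]. *)
Lemma sum_npoly_expr d (z : C) M : (M < q ^ d)%N ->
  \sum_(r : {poly_d F}) (z + ev (polyn r)) ^+ M = prod_neq0 d * (M == (q ^ d).-1)%:R.
Proof.
move=> Mq; have xinj : injective (fun r : {poly_d F} => z + ev (polyn r)).
  by move=> r s /addrI /evt_inj /val_inj.
have := lagrange_lead (p := 'X^M) xinj.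
rewrite card_npoly size_polyXn => /(_ Mq); rewrite coefXn eq_sym => <-.
rewrite mulr_sumr; apply: eq_bigr => r _; rewrite hornerXn.
suff -> : \prod_(j : {poly_d F} | j != r)
    (z + ev (polyn r) - (z + ev (polyn j))) = prod_neq0 d.
  rewrite mulrC divfK //; apply/prodf_neq0 => c c0.
  by rewrite evt_eq0.
rewrite (reindex (fun c : {poly_d F} => r - c)) /=; last first.
  by exists (fun c : {poly_d F} => r - c) => c _; rewrite opprB addrC subrK.
apply: eq_big => [c|c _].
  by rewrite -subr_eq0 addrAC subrr add0r oppr_eq0.
rewrite opprD addrACA subrr add0r -rmorphB; congr (ev _).
by rewrite /= opprB addrC subrK.
Qed.

Lemma msum_expr d M : (M < (q ^ d).-1)%N -> msum d (fun a => ev a ^+ M) = 0.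
Proof.
move=> Mq; rewrite /msum.
under eq_bigr do rewrite rmorphD /=.
by rewrite sum_npoly_expr ?ltn_eqF ?mulr0 //; lia.
Qed.

Lemma sum_neq0_expr d M : (0 < M < q ^ d)%N ->
  \sum_(c : {poly_d F} | polyn c != 0) ev (polyn c) ^+ M
  = prod_neq0 d * (M == (q ^ d).-1)%:R.
Proof.
move=> /andP[M0 Mq]; rewrite -(sum_npoly_expr 0 Mq) big_mkcond /=.
apply: eq_bigr => c _; rewrite add0r; case: eqVneq => //= ->.
by rewrite rmorph0 expr0n gtn_eqF.
Qed.

Lemma sum_neq0_1 d : (0 < d)%N ->
  \sum_(c : {poly_d F} | polyn c != 0) (1 : C) = -1.
Proof.
move=> d0; have := card_eq0 CI d0; rewrite -card_npoly -sumr_const.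
rewrite (bigD1 (0 : {poly_d F})) //= => /eqP; rewrite addrC addr_eq0 => /eqP <-.
by apply: eq_bigl => c; rewrite -(inj_eq val_inj).
Qed.

Definition quot_sum i J j : C :=
  \sum_(c : {poly_i F} | polyn c != 0)
    ev (polyn c) ^+ (q ^ j) / ev (polyn c) ^+ (q ^ J).

(** Each nonzero [c] of degree less than [i] is a root of [E_i]. *)
Lemma quot_sum_rel i J : \sum_(j < i.+1) wt i j * quot_sum i J j = 0.
Proof.
transitivity (\sum_(c : {poly_i F} | polyn c != 0)
    carlitzE CI i (polyn c) / ev (polyn c) ^+ (q ^ J)); last first.
  by apply: big1 => c _; rewrite carlitzE_small ?mul0r // size_npoly.
rewrite /quot_sum; under eq_bigr do rewrite mulr_sumr.
rewrite exchange_big; apply: eq_bigr => c _; rewrite /carlitzE mulr_suml.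
by apply: eq_bigr => j _; rewrite mulrA.
Qed.

Lemma quot_sum_gt i J j : (J < j <= i)%N ->
  quot_sum i J j = prod_neq0 i * ((j == i) && (J == 0%N))%:R.
Proof.
move=> /andP[Jj ji]; have q1 : (1 < q)%N := @q_gt1 F.
have qJj : (q ^ J < q ^ j)%N by rewrite ltn_exp2l.
have qji : (q ^ j <= q ^ i)%N by rewrite leq_exp2l.
have qJ : (0 < q ^ J)%N by rewrite expn_gt0 ltnW.
transitivity (\sum_(c : {poly_i F} | polyn c != 0) ev (polyn c) ^+ (q ^ j - q ^ J)).
  apply: eq_bigr => c c0; rewrite expf_div ?evt_eq0 // ltnNge ltnW //.
rewrite sum_neq0_expr; last by lia.
congr (prod_neq0 i * (nat_of_bool _)%:R).
have -> : (j == i) = (q ^ j == q ^ i)%N by rewrite eqn_exp2l.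
have -> : (J == 0)%N = (q ^ J == q ^ 0)%N by rewrite eqn_exp2l.
rewrite expn0; clear -qJj qji qJ.
move: (q ^ j)%N (q ^ i)%N (q ^ J)%N qJj qji qJ => a b c; lia.
Qed.

Lemma quot_sum_eq i J : (0 < i)%N -> quot_sum i J J = -1.
Proof.
move=> i0; rewrite -(sum_neq0_1 i0); apply: eq_bigr => c c0.
by rewrite divff // expf_neq0 // evt_eq0.
Qed.

Lemma const_expq (x : F) j : x ^+ (q ^ j) = x.
Proof. by elim: j => [|j IH]; rewrite ?expn0 ?expr1 // expnSr exprM IH expf_card. Qed.

Lemma sum_const_neq0 : \sum_(x : F | x != 0) (1 : C) = -1.
Proof.
have := card_eq0 CI (ltn0Sn 0); rewrite expn1 -sumr_const.
by rewrite (bigD1 0) //= => /eqP; rewrite addrC addr_eq0 => /eqP <-.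
Qed.

(** Each nonzero [c] is a constant times a monic polynomial, and the constants are
    fixed by the Frobenius, so that they contribute the factor [q - 1 = -1]. *)
Lemma quot_sum_lt i J j : (j < J)%N ->
  quot_sum i J j = - \sum_(e < i) power_sum CI e (q ^ J - q ^ j).
Proof.
move=> jJ; have q1 : (1 < q)%N := @q_gt1 F.
have qjJ : (q ^ j < q ^ J)%N by rewrite ltn_exp2l.
transitivity (\sum_(c : {poly_i F} | polyn c != 0)
    (ev (polyn c) ^+ (q ^ J - q ^ j))^-1).
  by apply: eq_bigr => c c0; rewrite expf_div ?evt_eq0 // qjJ.
rewrite (sum_npoly_neq0 i (fun c => (ev c ^+ (q ^ J - q ^ j))^-1)) -sumrN.
apply: eq_bigr => e _; rewrite -mulN1r -sum_const_neq0 mulr_suml.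
apply: eq_bigr => x x0; rewrite power_sumE mul1r.
apply: eq_bigr => r _; rewrite -mul_polyC rmorphM /= exprMn -rmorphXn -polyC_exp /=.
suff -> : x ^+ (q ^ J - q ^ j) = 1 by rewrite rmorph1 mul1r.
apply: (mulfI x0); rewrite mulr1 -{1}(const_expq x j) -exprD subnKC ?const_expq //.
exact: ltnW.
Qed.

Lemma prod_neq0E d : prod_neq0 d * wt d d = wt d 0.
Proof.
case: (posnP d) => [->|d0].
  rewrite /prod_neq0 big1 ?mul1r // => c; have := size_npoly c.
  by rewrite leqn0 size_poly_eq0 => ->.
have := quot_sum_rel d 0.
rewrite (bigD1 ord0) //= (bigD1 ord_max) /=; last by rewrite -(inj_eq val_inj) /=; lia.
rewrite big1 => [|j /andP[j0 jd]].
  rewrite quot_sum_eq // quot_sum_gt ?d0 ?leqnn // !eqxx mulr1 addr0 mulrN1.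
  by move=> /eqP; rewrite addrC subr_eq0 mulrC => /eqP.
rewrite -!(inj_eq val_inj) /= in j0 jd.
rewrite quot_sum_gt ?(negPf jd) ?mulr0 //.
by rewrite lt0n j0 -ltnS ltn_ord.
Qed.

(** Summing [E_d(a) = 1] against [1 / a]. *)
Lemma power_sum1 d : power_sum CI d 1 = wt d 0.
Proof.
rewrite power_sumE -prod_neq0E.
have q0 j : (0 < q ^ j)%N by rewrite expn_gt0 ltnW ?q_gt1.
transitivity (msum d (fun a => \sum_(j < d.+1) wt d j * ev a ^+ (q ^ j).-1)).
  apply: eq_msum => a ma sa; rewrite expr1 -[LHS]mul1r -(carlitzE_monic CI ma sa).
  rewrite /carlitzE mulr_suml; apply: eq_bigr => j _.
  rewrite -mulrA -{2}[ev a]expr1 expf_div ?ev_monic_neq0 // subn1.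
  by rewrite ltnNge q0.
rewrite /msum exchange_big big_ord_recr /= big1 ?add0r => [|j _]; last first.
  rewrite -mulr_sumr (_ : \sum_(_ | _) _ = msum d (fun a => ev a ^+ (q ^ j).-1)) //.
  rewrite msum_expr ?mulr0 //.
  have : (q ^ j < q ^ d)%N by rewrite ltn_exp2l ?q_gt1.
  by have := q0 j; lia.
rewrite -mulr_sumr mulrC; congr (_ * _).
under eq_bigr do rewrite rmorphD /=.
rewrite sum_npoly_expr; first by rewrite eqxx mulr1.
by rewrite prednK // q0.
Qed.

(** The coefficients of [E_i] are determined by its roots: summing [E_i(c) = 0]
    against [c ^ - q ^ J] over the nonzero [c] of degree less than [i], the
    nonnegative powers of [c] drop out. *)
Lemma lagrange_wt_rec i J : (0 < J)%N ->
  wt i J = - \sum_(j < J) wt i j * \sum_(e < i) power_sum CI e (q ^ J - q ^ j).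
Proof.
move=> J0; have wt0 j : (i < j)%N -> wt i j = 0.
  by move=> ij; rewrite /lagrange_wt leqNgt ij.
have := quot_sum_rel i J.
have -> : \sum_(j < i.+1) wt i j * quot_sum i J j =
    \sum_(0 <= j < (i + J).+1) wt i j * quot_sum i J j.
  rewrite (@big_cat_nat _ _ _ i.+1) //=; last by lia.
  rewrite big_mkord [X in _ = _ + X]big_nat_cond [X in _ = _ + X]big1 ?addr0 //.
  by move=> j /andP[/andP[ij _] _]; rewrite wt0 ?mul0r.
rewrite (@big_cat_nat _ _ _ J) //=; last by lia.
rewrite [X in _ + X]big_ltn; last by lia.
rewrite [X in _ + (_ + X)]big_nat_cond [X in _ + (_ + X)]big1 ?addr0; last first.
  move=> j /andP[/andP[Jj _] _]; case: (leqP j i) => ji; last by rewrite wt0 ?mul0r.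
  by rewrite quot_sum_gt ?Jj // [J == 0%N]gtn_eqF // andbF !mulr0.
have -> : wt i J * quot_sum i J J = - wt i J.
  case: (leqP J i) => Ji; last by rewrite wt0 ?mul0r ?oppr0.
  by rewrite quot_sum_eq ?mulrN1 // (leq_trans J0).
rewrite big_mkord => /eqP; rewrite subr_eq0 => /eqP <-; rewrite -sumrN.
by apply: eq_bigr => j _; rewrite quot_sum_lt // mulrN.
Qed.

(** Summing [E_d(a) = 1] against [1 / a ^ n]; the powers of [a] with a nonnegative
    exponent sum to [0]. *)
Lemma power_sum_rec d n : (1 < n)%N ->
  power_sum CI d n =
  \sum_(j < d.+1 | (q ^ j < n)%N) wt d j * power_sum CI d (n - q ^ j).
Proof.
move=> n1; rewrite power_sumE.
transitivity (msum d (fun a =>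
    \sum_(j < d.+1) wt d j * (ev a ^+ (q ^ j) / ev a ^+ n))).
  apply: eq_msum => a ma sa; rewrite -[LHS]mul1r -(carlitzE_monic CI ma sa).
  by rewrite /carlitzE mulr_suml; apply: eq_bigr => j _; rewrite mulrA.
transitivity (\sum_(j < d.+1) wt d j * msum d (fun a => ev a ^+ (q ^ j) / ev a ^+ n)).
  by rewrite /msum exchange_big; apply: eq_bigr => j _; rewrite mulr_sumr.
rewrite [RHS]big_mkcond /=; apply: eq_bigr => j _; case: ifPn => [jn|nj].
  rewrite power_sumE; congr (_ * _); apply: eq_msum => a ma sa.
  by rewrite expf_div ?ev_monic_neq0 // jn.
rewrite (_ : msum _ _ = msum d (fun a => ev a ^+ (q ^ j - n))).
  rewrite msum_expr ?mulr0 //.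
  have : (q ^ j <= q ^ d)%N by rewrite leq_exp2l ?q_gt1 // -ltnS ltn_ord.
  by move: nj; rewrite -leqNgt; move: (q ^ j)%N (q ^ d)%N => a b; lia.
by apply: eq_msum => a ma sa; rewrite expf_div ?ev_monic_neq0 // (negPf nj).
Qed.

End PowerSums.

(** * Nested sums and their quasi-shuffle product *)

Section NestedSums.
Context (K C : fieldType) (em : {rmorphism K -> C}) (V : finType) (W : Type).
Implicit Types (X Y I J : {set V}) (g h : W -> nat -> C).

Lemma disjointU3 X Y I :
  [disjoint X :|: Y & I] = [disjoint X & I] && [disjoint Y & I].
Proof. by rewrite -!finset.setI_eq0 finset.setIUl finset.setU_eq0. Qed.

Lemma disjoint3U X Y I :
  [disjoint I & X :|: Y] = [disjoint I & X] && [disjoint I & Y].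
Proof. by rewrite -!finset.setI_eq0 finset.setIUr finset.setU_eq0. Qed.

Variable S : W -> nat -> {set V} -> nat -> C.

(** The [K]-span of the nested sums of type [X] and weight [n] built from the
    terms [S w d I m] of degree [d], as functions of the parameter [w] and of the
    bound on the degree. With the boolean [false] the elements are sums over
    all strictly decreasing sequences of degrees less than [d]; with [true],
    the largest degree is exactly [d]. *)
Inductive nested : bool -> {set V} -> nat -> (W -> nat -> C) -> Prop :=
| nested_0 b X n : nested b X n (fun _ _ => 0)
| nested_lin b X n k g h : nested b X n g -> nested b X n h ->
    nested b X n (fun w d => em k * g w d + h w d)
| nested_1 : nested false finset.set0 0 (fun _ _ => 1)
| nested_sum X n g : nested true X n g ->
    nested false X n (fun w D => \sum_(d < D) g w d)
| nested_lead I J m n h : [disjoint I & J] -> (0 < m)%N -> nested false J n h ->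
    nested true (I :|: J) (m + n) (fun w d => S w d I m * h w d).

Lemma nested_ext b X n g h :
  (forall w d, g w d = h w d) -> nested b X n g -> nested b X n h.
Proof.
by move=> gh; suff -> : g = h by []; apply/funext => w; apply/funext => d.
Qed.

Lemma nested_eq b X Y n m g h : nested b X n g -> X = Y -> n = m ->
  (forall w d, g w d = h w d) -> nested b Y m h.
Proof. by move=> ng <- <- /nested_ext; apply. Qed.

Lemma nestedD b X n g h : nested b X n g -> nested b X n h ->
  nested b X n (fun w d => g w d + h w d).
Proof.
move=> ng nh; apply: nested_ext (nested_lin 1 ng nh) => w d.
by rewrite rmorph1 mul1r.
Qed.

Lemma nestedZ b X n k g : nested b X n g -> nested b X n (fun w d => em k * g w d).
Proof.
move=> ng; apply: nested_ext (nested_lin k ng (nested_0 b X n)) => w d.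
by rewrite addr0.
Qed.

Lemma nestedB b X n g h : nested b X n g -> nested b X n h ->
  nested b X n (fun w d => g w d - h w d).
Proof.
move=> ng nh; apply: nested_ext (nested_lin (-1) nh ng) => w d.
by rewrite rmorphN1 mulN1r addrC.
Qed.

Lemma nested_big b X n (I : Type) (r : seq I) (P : pred I) (G : I -> W -> nat -> C) :
  (forall i, P i -> nested b X n (G i)) ->
  nested b X n (fun w d => \sum_(i <- r | P i) G i w d).
Proof.
move=> nG; elim: r => [|i r IH].
  by apply: nested_ext (nested_0 b X n) => w d; rewrite big_nil.
case Pi: (P i); last by apply: nested_ext IH => w d; rewrite big_cons Pi.
by apply: nested_ext (nestedD (nG i Pi) IH) => w d; rewrite big_cons Pi.
Qed.

Lemma nested_term I m : (0 < m)%N -> nested true I m (fun w d => S w d I m).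
Proof.
move=> m0; have := @nested_lead I finset.set0 m 0 _ _ m0 nested_1.
rewrite -finset.setI_eq0 finset.setI0 eqxx => /(_ isT) nI.
by apply: nested_eq nI _ _ _ => [||w d]; rewrite ?finset.setU0 ?addn0 ?mulr1.
Qed.

Hypothesis termM : forall I J m n, [disjoint I & J] -> (0 < m)%N -> (0 < n)%N ->
  nested true (I :|: J) (m + n) (fun w d => S w d I m * S w d J n).

Section Step.
Variable N : nat.
Hypothesis IH : forall X Y m n g h, (m + n < N)%N -> [disjoint X & Y] ->
  nested false X m g -> nested false Y n h ->
  nested false (X :|: Y) (m + n) (fun w d => g w d * h w d).

Let mul_lead_tail b X m g : nested b X m g -> b = true ->
  forall Y n h, (m + n <= N)%N -> [disjoint X & Y] -> nested false Y n h ->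
  nested true (X :|: Y) (m + n) (fun w d => g w d * h w d).
Proof.
elim=> {b X m g} [b X m _|b X m k g g' _ IHg _ IHg' bT|//|//
  |I J m n0 h0 dIJ m0 nh0 _ _] Y n h mn dXY nh.
- by apply: nested_ext (nested_0 _ _ _) => w d; rewrite mul0r.
- apply: nested_ext (nested_lin k (IHg bT _ _ _ mn dXY nh) (IHg' bT _ _ _ mn dXY nh)) => w d.
  by rewrite mulrDl mulrA.
- move: dXY; rewrite disjointU3 => /andP[dIY dJY].
  have nhh : nested false (J :|: Y) (n0 + n) (fun w d => h0 w d * h w d).
    by apply: IH => //; lia.
  have := nested_lead (I := I) _ m0 nhh; rewrite disjoint3U dIJ => /(_ dIY) nI.
  by apply: nested_eq nI _ _ _ => [||w d]; rewrite ?finset.setUA ?addnA ?mulrA.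
Qed.

Let mul_lead_lead b X m g : nested b X m g -> b = true ->
  forall b' Y n h, nested b' Y n h -> b' = true -> (m + n <= N)%N ->
  [disjoint X & Y] -> nested true (X :|: Y) (m + n) (fun w d => g w d * h w d).
Proof.
elim=> {b X m g} [b X m _|b X m k g g' _ IHg _ IHg' bT|//|//
  |I J m n0 h0 dIJ m0 nh0 _ _] b' Y n h nh bT' mn dXY.
- by apply: nested_ext (nested_0 _ _ _) => w d; rewrite mul0r.
- apply: nested_ext (nested_lin k (IHg bT _ _ _ _ nh bT' mn dXY)
    (IHg' bT _ _ _ _ nh bT' mn dXY)) => w d.
  by rewrite mulrDl mulrA.
elim: nh bT' mn dXY => {b' Y n h} [b' Y n _ _ _|b' Y n k h h' _ IHh _ IHh' bT' mn dXY|//|//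
  |I' J' m' n' h' dIJ' m0' nh' _ _ mn].
- by apply: nested_ext (nested_0 _ _ _) => w d; rewrite mulr0.
- apply: nested_ext (nested_lin k (IHh bT' mn dXY) (IHh' bT' mn dXY)) => w d.
  by rewrite mulrDr mulrCA.
- rewrite disjointU3 !disjoint3U => /andP[/andP[dII dIJ''] /andP[dJI dJJ]].
  have nhh : nested false (J :|: J') (n0 + n') (fun w d => h0 w d * h' w d).
    by apply: IH => //; lia.
  have := mul_lead_tail (termM dII m0 m0') erefl _ _ nhh.
  rewrite disjointU3 !disjoint3U dIJ dIJ'' [[disjoint I' & J]]disjoint_sym dJI dIJ' => nI.
  apply: nested_eq (nI _ isT) _ _ _ => [|||w d]; first by lia.
  + by rewrite -!finset.setUA; congr (_ :|: _); rewrite finset.setUCA.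
  + lia.
  + by rewrite mulrACA.
Qed.

Let mul_tail_tail b X m g : nested b X m g -> b = false ->
  forall b' Y n h, nested b' Y n h -> b' = false -> (m + n <= N)%N ->
  [disjoint X & Y] -> nested false (X :|: Y) (m + n) (fun w d => g w d * h w d).
Proof.
elim=> {b X m g} [b X m _|b X m k g g' _ IHg _ IHg' bT|_|X m g ng _ _|//]
  b' Y n h nh bT' mn dXY.
- by apply: nested_ext (nested_0 _ _ _) => w d; rewrite mul0r.
- apply: nested_ext (nested_lin k (IHg bT _ _ _ _ nh bT' mn dXY)
    (IHg' bT _ _ _ _ nh bT' mn dXY)) => w d.
  by rewrite mulrDl mulrA.
- move: nh; rewrite bT' => nh.
  by apply: nested_eq nh _ _ _ => [||w d]; rewrite ?finset.set0U ?mul1r.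
have ngs := nested_sum ng.
elim: nh bT' mn dXY => {b' Y n h} [b' Y n _ _ _|b' Y n k h h' _ IHh _ IHh' bT' mn dXY|_ _ _
  |Y n h nh _ _ mn dXY|//].
- by apply: nested_ext (nested_0 _ _ _) => w d; rewrite mulr0.
- apply: nested_ext (nested_lin k (IHh bT' mn dXY) (IHh' bT' mn dXY)) => w d.
  by rewrite mulrDr mulrCA.
- by apply: nested_eq ngs _ _ _ => [||w d]; rewrite ?finset.setU0 ?addn0 ?mulr1.
have nhs := nested_sum nh.
have n1 := mul_lead_tail ng erefl mn dXY nhs.
have n2 : nested true (X :|: Y) (m + n) (fun w d => h w d * \sum_(e < d) g w e).
  have := mul_lead_tail nh erefl _ _ ngs.
  rewrite addnC disjoint_sym => /(_ mn dXY) n2.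
  by apply: nested_eq n2 _ _ _ => //; rewrite finset.setUC.
have n3 := mul_lead_lead ng erefl nh erefl mn dXY.
apply: nested_ext (nested_sum (nestedD (nestedD n1 n2) n3)) => w D.
elim: D => [|D IHD]; first by rewrite !big_ord0 mul0r.
by rewrite !big_ord_recr /= IHD; ring.
Qed.

Lemma nestedM_step X Y m n g h : (m + n <= N)%N -> [disjoint X & Y] ->
  nested false X m g -> nested false Y n h ->
  nested false (X :|: Y) (m + n) (fun w d => g w d * h w d).
Proof.
by move=> mn dXY ng nh; exact: mul_tail_tail ng erefl _ _ _ _ nh erefl mn dXY.
Qed.

Lemma nestedM_lead_step X Y m n g h : (m + n <= N)%N -> [disjoint X & Y] ->
  nested true X m g -> nested false Y n h ->
  nested true (X :|: Y) (m + n) (fun w d => g w d * h w d).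
Proof. by move=> mn dXY ng nh; exact: mul_lead_tail ng erefl _ _ _ mn dXY nh. Qed.

End Step.

(** The quasi-shuffle product. The diagonal terms of a product are products
    [S w d I m * S w d J n * (h * h')], where [h * h'] has a smaller weight than
    the whole product: hence an induction on the total weight. *)
Lemma nestedM X Y m n g h : [disjoint X & Y] ->
  nested false X m g -> nested false Y n h ->
  nested false (X :|: Y) (m + n) (fun w d => g w d * h w d).
Proof.
have [N mn] : exists N, (m + n <= N)%N by exists (m + n)%N.
elim/ltn_ind: N => N IHN in X Y m n g h mn *.
apply: (nestedM_step (N := N)) => // X' Y' m' n' g' h' mn'.
exact: IHN mn' _ _ _ _ _ _ (leqnn _).
Qed.

Lemma nestedM_lead X Y m n g h : [disjoint X & Y] ->
  nested true X m g -> nested false Y n h ->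
  nested true (X :|: Y) (m + n) (fun w d => g w d * h w d).
Proof.
by apply: (@nestedM_lead_step (m + n)) => // X' Y' m' n' g' h' _; exact: nestedM.
Qed.

End NestedSums.

(** Nested sums of empty type only involve the terms of empty type, so that they
    can be transported to any other family with the same such terms. *)
Lemma nested_set0 (K C : fieldType) (em : {rmorphism K -> C}) (V V' : finType)
    (W W' : Type) (S : W -> nat -> {set V} -> nat -> C)
    (S' : W' -> nat -> {set V'} -> nat -> C) (w0 : W) b n g :
  (forall w' d m, S' w' d finset.set0 m = S w0 d finset.set0 m) ->
  nested em S b finset.set0 n g ->
  nested em S' b finset.set0 n (fun _ d => g w0 d).
Proof.
move=> SS; suff gen X : nested em S b X n g -> X = finset.set0 ->
    nested em S' b finset.set0 n (fun _ d => g w0 d) by move=> /gen; apply.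
elim=> {b X n g} [b X n|b X n k g h _ IHg _ IHh||X n g _ IHg
  |I J m n h dIJ m0 nh IHh] X0.
- exact: nested_0.
- by apply: nested_lin; [apply: IHg|apply: IHh].
- exact: nested_1.
- exact: nested_sum (IHg X0).
have /andP[/eqP I0 /eqP J0] : (I == finset.set0) && (J == finset.set0).
  by rewrite -finset.setU_eq0 X0.
have nh' := IHh J0.
have d0 : [disjoint (@finset.set0 V') & finset.set0].
  by rewrite -finset.setI_eq0 finset.setI0.
have := nested_lead d0 m0 nh'; rewrite finset.setU0; apply: nested_ext => w d.
by rewrite I0 SS.
Qed.

(** * Zeta terms and weighted terms *)

Section Families.
Context (R : realType) (F : finFieldType) (C : fieldType) (CI : Cinfty R F C).
Context (V : finType).
Implicit Types (I J L X Y : {set V}) (t : V -> C) (w : V -> nat -> C).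

Local Notation q := #|F|.
Local Notation ev := (evt CI).
Local Notation evat := (evat CI).

Definition eval_set I (a : {poly F}) t : C := \prod_(k in I) evat a (t k).

Definition zeta_term t d I m : C := msum d (fun a => eval_set I a t / ev a ^+ m).

(** For [w k d = X_k ^ (q ^ d)] the nested sums of these terms are the truncated
    multiple polylogarithms; for [w k d = b_d(t_k)] and less than [q] variables they
    span the same functions of [t] as the truncated multiple zeta values. *)
Definition weight_term w d I m : C := power_sum CI d m * \prod_(k in I) w k d.

Local Notation znested := (nested (emb CI) zeta_term).
Local Notation wnested := (nested (emb CI) weight_term).

Lemma eval_set0 a t : eval_set finset.set0 a t = 1.
Proof. by rewrite /eval_set big_set0. Qed.

Lemma eval_setU I J a t : [disjoint I & J] ->
  eval_set (I :|: J) a t = eval_set I a t * eval_set J a t.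
Proof.
by move=> dIJ; rewrite /eval_set (eq_bigl [predU I & J]) ?bigU // => k; rewrite !inE.
Qed.

Lemma eval_setU1 k I a t : k \notin I ->
  eval_set (k |: I) a t = evat a (t k) * eval_set I a t.
Proof. by move=> kI; rewrite /eval_set big_setU1. Qed.

Lemma eval_setZ x I a t :
  eval_set I (x *: a) t = const_emb CI (x ^+ #|I|) * eval_set I a t.
Proof.
rewrite rmorphXn /= -prodr_const -big_split; apply: eq_bigr => k _ /=.
by rewrite -mul_polyC evatM evatC.
Qed.

Lemma sum_neq0_zeta t d L j :
  \sum_(c : {poly_d F} | polyn c != 0) eval_set L (polyn c) t / ev (polyn c) ^+ j =
  const_emb CI (\sum_(x : F | x != 0) x ^+ #|L| / x ^+ j) *
  \sum_(e < d) zeta_term t e L j.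
Proof.
rewrite (sum_npoly_neq0 d (fun c => eval_set L c t / ev c ^+ j)) mulr_sumr.
apply: eq_bigr => e _; rewrite rmorph_sum mulr_suml; apply: eq_bigr => x x0 /=.
rewrite /zeta_term /msum mulr_sumr; apply: eq_bigr => r _.
rewrite eval_setZ -mul_polyC rmorphM /= exprMn invfM fmorph_div !rmorphXn /=.
by rewrite mulrACA.
Qed.

Let shifted t d I J L m j : C :=
  \sum_(r : {poly_d F}) \sum_(c : {poly_d F} | polyn c != 0)
    eval_set I ('X^d + polyn r) t * eval_set J ('X^d + polyn r - polyn c) t
    * eval_set L (polyn c) t / ev ('X^d + polyn r) ^+ m / ev (polyn c) ^+ j.

(** The factors [a(t_k) - c(t_k)], [k] in [J], are expanded one at a time; the sums
    over [a] and over [c] then separate. *)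
Let nested_shifted I J L m j : (0 < m)%N -> (0 < j)%N ->
  [disjoint I & J] -> [disjoint I & L] -> [disjoint J & L] ->
  znested true (I :|: J :|: L) (m + j) (fun t d => shifted t d I J L m j).
Proof.
move=> m0 j0; have [N JN] : exists N, (#|J| <= N)%N by exists #|J|.
elim: N => [|N IH] in I J L JN * => dIJ dIL dJL.
  have -> : J = finset.set0 by apply/eqP; rewrite -cards_eq0 -leqn0.
  rewrite finset.setU0.
  have nL := nestedZ (tofrac (\sum_(x : F | x != 0) x ^+ #|L| / x ^+ j)%:P)
     (nested_sum (nested_term (emb CI) zeta_term L j0)).
  have := nested_lead (I := I) dIL m0 nL; apply: nested_ext => t d /=.
  rewrite -[emb CI _]/(const_emb CI _) -sum_neq0_zeta mulr_suml.
  apply: eq_bigr => r _; rewrite mulr_sumr; apply: eq_bigr => c _.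
  by rewrite eval_set0 mulr1; ring.
have [J0|[k kJ]] := finset.set_0Vmem J.
  by apply: IH => //; rewrite J0 cards0.
have kJ' : k \notin J :\ k by rewrite !inE eqxx.
have JE := finset.setD1K kJ.
have JN' : (#|J :\ k| <= N)%N by have := cardsD1 k J; rewrite kJ; lia.
move: dIJ dJL; rewrite -{1 2}JE disjoint3U disjointU3 => /andP[dIk dIJ] /andP[dkL dJL].
have kI : k \notin I by move: dIk; rewrite disjoint_sym disjoints1.
have kL : k \notin L by move: dkL; rewrite disjoints1.
have dk : [disjoint [set k] & J :\ k] by rewrite disjoints1.
have n1 : znested true (I :|: J :|: L) (m + j)
    (fun t d => shifted t d (k |: I) (J :\ k) L m j).
  have := IH (k |: I) (J :\ k) L JN'; rewrite !disjointU3 dIJ dk dIL dkL.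
  move/(_ isT isT dJL) => n1; apply: nested_eq n1 _ _ _ => //.
  by rewrite -{2}JE finset.setUA [I :|: _]finset.setUC.
have n2 : znested true (I :|: J :|: L) (m + j)
    (fun t d => shifted t d I (J :\ k) (k |: L) m j).
  have := IH I (J :\ k) (k |: L) JN' dIJ; rewrite !disjoint3U dJL dIk dIL.
  rewrite disjoint_sym dk => /(_ isT isT) n2; apply: nested_eq n2 _ _ _ => //.
  by rewrite -{2}JE -!finset.setUA; congr (_ :|: _); rewrite finset.setUCA.
apply: nested_ext (nestedB n1 n2) => t d; rewrite /shifted -sumrB.
apply: eq_bigr => r _; rewrite -sumrB; apply: eq_bigr => c _.
rewrite -{3}JE !eval_setU1 // evatB; ring.
Qed.

Let off_diag t d I J m n j : C :=
  \sum_(r : {poly_d F}) \sum_(c : {poly_d F} | polyn c != 0)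
    eval_set I ('X^d + polyn r) t * eval_set J ('X^d + polyn r - polyn c) t
    / ev ('X^d + polyn r) ^+ m / ev ('X^d + polyn r - polyn c) ^+ n
    / ev (polyn c) ^+ j.

Let off_diag_swap t d I J n j :
  off_diag t d I J 0 n j = (-1) ^+ j * off_diag t d J I n 0 j.
Proof.
rewrite /off_diag exchange_big /= (reindex_inj oppr_inj) /= mulr_sumr.
rewrite [RHS](eq_bigr _ (fun r _ => mulr_sumr _ _ _ _)) [RHS]exchange_big /=.
apply: eq_big => [c|c c0]; first by rewrite oppr_eq0.
rewrite (reindex (fun r => r - c)) /=; last first.
  by exists (fun r => r + c) => r _; rewrite ?subrK ?addrK.
apply: eq_bigr => r _.
have -> : 'X^d + (polyn r - polyn c) - - polyn c = 'X^d + polyn r.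
  by rewrite opprK addrA subrK.
rewrite addrA !expr0 !divr1 rmorphN /= (exprNn (ev (polyn c))) invfM.
have -> : ((-1) ^+ j)^-1 = (-1) ^+ j :> C by rewrite -exprVn invrN1.
ring.
Qed.

(** Partial fractions: with [c = a - b], the product [1 / (a b)] is
    [(1 / b - 1 / a) / c]. Applied repeatedly, this leaves one of [a], [b] in the
    denominator together with [c], and then the pairs (a, c) can be summed
    independently. *)
Let nested_off_diag I J m n j : [disjoint I & J] ->
  (0 < m + n)%N -> (0 < j)%N || (0 < m)%N && (0 < n)%N ->
  znested true (I :|: J) (m + n + j) (fun t d => off_diag t d I J m n j).
Proof.
have base I' J' m' j' : [disjoint I' & J'] -> (0 < m')%N -> (0 < j')%N ->
    znested true (I' :|: J') (m' + j') (fun t d => off_diag t d I' J' m' 0 j').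
  move=> dIJ m0 j0; have := @nested_shifted I' J' finset.set0 _ _ m0 j0 dIJ.
  rewrite -!finset.setI_eq0 !finset.setI0 eqxx => /(_ isT isT) nI.
  apply: nested_eq nI _ _ _ => [|//|t d]; first by rewrite finset.setU0.
  apply: eq_bigr => r _; apply: eq_bigr => c _.
  by rewrite eval_set0 mulr1 expr0 divr1.
move=> dIJ; elim: m n j => [|m IHm] n j.
  rewrite ltnn /= orbF add0n => n0 j0; have := base J I n j.
  rewrite disjoint_sym => /(_ dIJ n0 j0) nI.
  have := nestedZ ((-1) ^+ j) nI; rewrite finset.setUC; apply: nested_ext => t d.
  by rewrite off_diag_swap rmorphXn rmorphN1.
elim: n j => [|n IHn] j.
  move=> _; by rewrite ltnn andbF orbF addn0 => j0; apply: base.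
move=> _ _; have n1 := IHm n.+1 j.+1; rewrite addnS in n1.
have n2 := nested_eq (IHn j.+1 isT isT) erefl _ (fun _ _ => erefl).
have wE : (m.+1 + n.+1 + j = (m + n).+1 + j.+1)%N by lia.
rewrite wE; have := nestedB (n1 isT isT) (n2 _ _).
move=> nB; apply: nested_ext (nB _) => [t d|]; last by lia.
rewrite /off_diag -sumrB; apply: eq_bigr => r _; rewrite -sumrB.
apply: eq_bigr => c c0; rewrite !exprS rmorphB /=.
have a0 := ev_monic_neq0 CI (mon_monic r).
have c0' : ev (polyn c) != 0 by rewrite evt_eq0.
have b0 : ev ('X^d + polyn r) - ev (polyn c) != 0.
  rewrite -rmorphB evt_eq0 -addrA.
  by have := monic_neq0 (mon_monic (r - c)).
move: (ev _) (ev _) a0 c0' b0 => a c' a0 c0' b0.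
move: (a ^+ m) ((a - c') ^+ n) (c' ^+ j)
  (expf_neq0 m a0) (expf_neq0 n b0) (expf_neq0 j c0') => x y z x0 y0 z0.
field; by rewrite ?x0 ?y0 ?z0 ?a0 ?b0 ?c0'.
Qed.

Lemma zeta_termM I J m n : [disjoint I & J] -> (0 < m)%N -> (0 < n)%N ->
  znested true (I :|: J) (m + n)
    (fun t d => zeta_term t d I m * zeta_term t d J n).
Proof.
move=> dIJ m0 n0.
have mn0 : (0 < m + n)%N by rewrite addn_gt0 m0.
have := nested_off_diag (j := 0) dIJ mn0; rewrite m0 n0 addn0 => /(_ isT) nO.
have nD := nested_term (emb CI) zeta_term (I :|: J) mn0.
apply: nested_ext (nestedD nD nO) => t d.
rewrite /zeta_term /msum mulr_suml -big_split; apply: eq_bigr => r _ /=.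
rewrite mulr_sumr [RHS](_ : _ = \sum_(c : {poly_d F})
    eval_set I ('X^d + polyn r) t * eval_set J ('X^d + polyn r - polyn c) t
    / ev ('X^d + polyn r) ^+ m / ev ('X^d + polyn r - polyn c) ^+ n); last first.
  rewrite [LHS](reindex (fun c => r - c)) /=; last first.
    by exists (fun c => r - c) => c _; rewrite opprB addrC subrK.
  by apply: eq_bigr => c _; rewrite addrA mulrACA !mulrA.
rewrite [RHS](bigD1 0) //= subr0 eval_setU // exprD invfM !mulrA; congr (_ + _).
apply: eq_big => [c|c _]; first by rewrite -(inj_eq val_inj).
by rewrite expr0 divr1.
Qed.

(** Multiplying the leading terms by further weights only enlarges their type. *)
Lemma nested_weight X Y n g : [disjoint Y & X] -> wnested true X n g ->
  wnested true (Y :|: X) n (fun w d => \prod_(k in Y) w k d * g w d).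
Proof.
move: {-2}true (erefl true) => b bT dYX ng.
elim: ng bT dYX => {b X n g} [b X n _ _|b X n k g h _ IHg _ IHh bT dYX|//|//
  |I J m n h dIJ m0 nh _ _].
- by apply: nested_ext (nested_0 _ _ _ _ _) => w d; rewrite mulr0.
- apply: nested_ext (nested_lin k (IHg bT dYX) (IHh bT dYX)) => w d.
  by rewrite mulrDr mulrCA.
rewrite disjoint3U => /andP[dYI dYJ].
have := nested_lead (I := Y :|: I) _ m0 nh; rewrite disjointU3 dIJ dYJ => /(_ isT) nI.
apply: nested_eq nI _ _ _ => [|//|w d]; first by rewrite finset.setUA.
rewrite mulrA /weight_term (eq_bigl [predU Y & I]) => [|k]; last by rewrite !inE.
by rewrite bigU //= mulrCA.
Qed.

Lemma zeta_term0 t d m : zeta_term t d finset.set0 m = power_sum CI d m.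
Proof. by rewrite power_sumE; apply: eq_bigr => r _; rewrite eval_set0 mul1r. Qed.

Lemma weight_term0 w d m : weight_term w d finset.set0 m = power_sum CI d m.
Proof. by rewrite /weight_term big_set0 mulr1. Qed.

Lemma disjoint00 : [disjoint (@finset.set0 V) & finset.set0].
Proof. by rewrite -finset.setI_eq0 finset.setI0. Qed.

(** The weights factor out of the product, which leaves the case of the zeta terms
    of empty type. *)
Lemma weight_termM I J m n : [disjoint I & J] -> (0 < m)%N -> (0 < n)%N ->
  wnested true (I :|: J) (m + n)
    (fun w d => weight_term w d I m * weight_term w d J n).
Proof.
move=> dIJ m0 n0; have z0 := zeta_termM disjoint00 m0 n0; rewrite finset.setU0 in z0.
have S0 w d l : weight_term w d finset.set0 l = zeta_term (fun _ => 0) d finset.set0 l.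
  by rewrite weight_term0 zeta_term0.
have n00 := nested_set0 S0 z0.
have dIJ0 : [disjoint I :|: J & finset.set0] by rewrite -finset.setI_eq0 finset.setI0.
have := nested_weight dIJ0 n00; rewrite finset.setU0; apply: nested_ext => w d.
rewrite !zeta_term0 (eq_bigl [predU I & J]) => [|k]; last by rewrite !inE.
by rewrite bigU //= /weight_term mulrC mulrACA.
Qed.

Definition znestedM := nestedM zeta_termM.
Definition znestedM_lead := nestedM_lead zeta_termM.
Definition wnestedM := nestedM weight_termM.
Definition wnestedM_lead := nestedM_lead weight_termM.

End Families.

(** * Exchanging zeta terms and weighted terms *)

Section Exchange.
Context (R : realType) (F : finFieldType) (C : fieldType) (CI : Cinfty R F C).
Context (V : finType).
Implicit Types (I J L X Y : {set V}) (t : V -> C) (w : V -> nat -> C).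

Local Notation q := #|F|.
Local Notation ev := (evt CI).
Local Notation evat := (evat CI).
Local Notation wt := (lagrange_wt CI).
Local Notation znested := (nested (emb CI) (zeta_term CI (V := V))).
Local Notation wnested := (nested (emb CI) (weight_term CI (V := V))).

Definition newton_weight t : V -> nat -> C := fun k d => newton CI d (t k).

(** By [lagrange_wt_rec] and the quasi-shuffle product. *)
Lemma nested_lagrange_wt j : wnested true finset.set0 (q ^ j) (fun _ d => wt d j).
Proof.
elim/ltn_ind: j => -[_|j IH].
  apply: nested_ext (nested_term _ _ _ (ltn0Sn 0)) => w d.
  by rewrite weight_term0 power_sum1.
have q1 := @q_gt1 F.
have nj (i : 'I_j.+1) : wnested true finset.set0 (q ^ j.+1) (fun _ d =>
    wt d i * \sum_(e < d) power_sum CI e (q ^ j.+1 - q ^ i)).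
  have qij : (q ^ i < q ^ j.+1)%N by rewrite ltn_exp2l.
  have m0 : (0 < q ^ j.+1 - q ^ i)%N by rewrite subn_gt0.
  have := wnestedM_lead (disjoint00 V) (IH i (ltn_ord i))
    (nested_sum (nested_term (emb CI) (weight_term CI (V := V)) finset.set0 m0)).
  move=> nI; apply: nested_eq nI _ _ _ => [||w d].
  - by rewrite finset.setU0.
  - by rewrite subnKC // ltnW.
  by congr (_ * _); apply: eq_bigr => e _; rewrite weight_term0.
have := nestedZ (-1) (nested_big (index_enum _) (P := xpredT) (fun i _ => nj i)).
apply: nested_ext => w d.
by rewrite lagrange_wt_rec // rmorphN1 mulN1r.
Qed.

Definition tail w k j d : C := \sum_(i < d) w k i * wt i j.

Lemma nested_tail k j : wnested false [set k] (q ^ j) (fun w d => tail w k j d).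
Proof.
have d0 : [disjoint [set k] & finset.set0] by rewrite -finset.setI_eq0 finset.setI0.
have := nested_sum (nested_weight d0 (nested_lagrange_wt j)); rewrite finset.setU0.
by apply: nested_ext => w d; apply: eq_bigr => i _; rewrite big_set1.
Qed.

Lemma tail_eq0 w k j d : (d <= j)%N -> tail w k j d = 0.
Proof.
move=> dj; apply: big1 => i _; rewrite /lagrange_wt leqNgt.
by rewrite (leq_trans (ltn_ord i) dj) mulr0.
Qed.

(** The Newton expansion of [a(t)], with the [E_i(a)] expanded in powers of [a] and
    the terms collected by powers. *)
Lemma evat_tail (a : {poly F}) t k d : a \is monic -> size a = d.+1 ->
  evat a (t k) =
  newton CI d (t k) + \sum_(j < d) tail (newton_weight t) k j d * ev a ^+ (q ^ j).
Proof.
move=> ma sa; rewrite (evat_expand CI _ ma sa); congr (_ + _).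
rewrite /tail; under [RHS]eq_bigr do rewrite mulr_suml.
rewrite [RHS]exchange_big /=; apply: eq_bigr => i _.
rewrite /carlitzE mulr_sumr (big_ord_widen_cond d xpredT
  (fun j => newton CI i (t k) * (wt i j * ev a ^+ (q ^ j)))) //.
rewrite big_mkcond /=; apply: eq_bigr => j _; case: ltnP => [|ij].
  by rewrite mulrA.
by rewrite /lagrange_wt leqNgt ij mulr0 mul0r.
Qed.

(** Expanding every [a(t_k)] leaves power sums whose exponents are less than
    [q ^ d - 1]. *)
Lemma msum_eval_set0 t d I M : (M + #|I| * q ^ d.-1 < (q ^ d).-1)%N ->
  msum d (fun a => eval_set CI I a t * ev a ^+ M) = 0.
Proof.
have [N IN] : exists N, (#|I| <= N)%N by exists #|I|.
elim: N => [|N IH] in I M IN *.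
  have -> : I = finset.set0 by apply/eqP; rewrite -cards_eq0 -leqn0.
  rewrite cards0 mul0n addn0 => Mq; rewrite -[RHS](msum_expr CI Mq).
  by apply: eq_bigr => r _; rewrite eval_set0 mul1r.
have [->|[k kI]] := finset.set_0Vmem I; first by apply: IH; rewrite cards0.
have kI' : k \notin I :\ k by rewrite !inE eqxx.
have := cardsD1 k I; rewrite kI /= => cI; rewrite cI mulnDl mul1n => MI.
have I'N : (#|I :\ k| <= N)%N by lia.
transitivity (newton CI d (t k) * msum d (fun a => eval_set CI (I :\ k) a t * ev a ^+ M)
   + \sum_(j < d) tail (newton_weight t) k j d *
       msum d (fun a => eval_set CI (I :\ k) a t * ev a ^+ (M + q ^ j))).
  rewrite /msum; under [X in _ = _ + X]eq_bigr do rewrite mulr_sumr.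
  rewrite [X in _ = _ + X]exchange_big mulr_sumr -big_split /=.
  apply: eq_bigr => r _; rewrite -{1}(finset.setD1K kI) eval_setU1 //.
  rewrite (evat_tail t k (mon_monic r) (size_mon r)) !mulrDl; congr (_ + _).
    by rewrite mulrA.
  rewrite !mulr_suml; apply: eq_bigr => j _; rewrite exprD; ring.
rewrite IH //; last by apply: leq_ltn_trans MI; rewrite leq_add2l leq_addl.
rewrite mulr0 add0r big1 // => j _; rewrite IH ?mulr0 //.
have : (q ^ j <= q ^ d.-1)%N.
  by rewrite leq_exp2l ?q_gt1 //; have := ltn_ord j; lia.
by move=> qj; apply: leq_ltn_trans MI; rewrite -addnA leq_add2l leq_add2r.
Qed.

(** Replacing [a(t_k)] by its expansion [evat_tail]. As there are less than [q]
    variables, the sums in which [a] has a nonnegative exponent vanish. *)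
Lemma zeta_term_rec t d k I n : k \notin I -> (#|I|.+1 < q)%N -> (0 < n)%N ->
  zeta_term CI t d (k |: I) n =
  newton CI d (t k) * zeta_term CI t d I n +
  \sum_(j < n | (q ^ j < n)%N)
    tail (newton_weight t) k j d * zeta_term CI t d I (n - q ^ j).
Proof.
move=> kI Iq n0; have q1 := @q_gt1 F.
transitivity (newton CI d (t k) * zeta_term CI t d I n +
   \sum_(j < d) tail (newton_weight t) k j d *
       msum d (fun a => eval_set CI I a t * (ev a ^+ (q ^ j) / ev a ^+ n))).
  rewrite /zeta_term /msum; under [X in _ = _ + X]eq_bigr do rewrite mulr_sumr.
  rewrite [X in _ = _ + X]exchange_big mulr_sumr -big_split /=.
  apply: eq_bigr => r _; rewrite eval_setU1 //.
  rewrite (evat_tail t k (mon_monic r) (size_mon r)) !mulrDl; congr (_ + _).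
    by rewrite mulrA.
  rewrite !mulr_suml; apply: eq_bigr => j _; ring.
congr (_ + _).
transitivity (\sum_(0 <= j < d + n | (q ^ j < n)%N)
    tail (newton_weight t) k j d * zeta_term CI t d I (n - q ^ j)); last first.
  rewrite (@big_cat_nat _ _ _ n) //=; last exact: leq_addl.
  rewrite big_mkord [X in _ + X]big_nat_cond [X in _ + X]big1 ?addr0 //.
  move=> j /andP[/andP[nj _] jn]; exfalso.
  by rewrite ltnNge (leq_trans nj (ltnW (ltn_expl j q1))) in jn.
rewrite (@big_cat_nat _ _ _ d) //=; last exact: leq_addr.
rewrite [X in _ = _ + X]big_nat_cond [X in _ = _ + X]big1 ?addr0; last first.
  by move=> j /andP[/andP[dj _] _]; rewrite tail_eq0 ?mul0r.
rewrite big_mkord [RHS]big_mkcond /=; apply: eq_bigr => j _; case: ifPn => [jn|nj].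
  congr (_ * _); apply: eq_msum => a ma sa.
  by rewrite expf_div ?ev_monic_neq0 // jn.
rewrite (_ : msum _ _ = msum d (fun a => eval_set CI I a t * ev a ^+ (q ^ j - n))).
  rewrite msum_eval_set0 ?mulr0 //.
  have jd : (q ^ j <= q ^ d.-1)%N by rewrite leq_exp2l //; have := ltn_ord j; lia.
  have d0 : (0 < d)%N by have := ltn_ord j; lia.
  have -> : (q ^ d = q * q ^ d.-1)%N by rewrite -expnS prednK.
  move: nj; rewrite -leqNgt; move: (q ^ j)%N (q ^ d.-1)%N jd => a b ab na.
  by have : ((#|I| + 2) * b <= q * b)%N; [rewrite leq_mul2r; lia | lia].
by apply: eq_msum => a ma sa; rewrite expf_div ?ev_monic_neq0 // (negPf nj).
Qed.

Hypothesis Vq : (#|V| < q)%N.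

Let cardIq k I : k \notin I -> (#|I|.+1 < q)%N.
Proof.
move=> kI; apply: leq_ltn_trans Vq; rewrite -add1n.
by have := cardsU1 k I; rewrite kI => <-; exact: max_card.
Qed.

(** The functions of [t] obtained from the weighted sums by the weights
    [newton_weight t]. *)
Let at_newton b X n (f : (V -> C) -> nat -> C) : Prop :=
  exists2 g, wnested b X n g & forall t d, f t d = g (newton_weight t) d.

Let at_newton_big b X n (T : Type) (r : seq T) (P : pred T)
    (f : T -> (V -> C) -> nat -> C) :
  (forall i, P i -> at_newton b X n (f i)) ->
  at_newton b X n (fun t d => \sum_(i <- r | P i) f i t d).
Proof.
move=> nf; elim: r => [|i r [g ng fg]].
  by exists (fun _ _ => 0); [exact: nested_0 | move=> t d; rewrite big_nil].
case Pi: (P i); last by exists g => // t d; rewrite big_cons Pi fg.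
have [h nh fh] := nf i Pi; exists (fun w d => h w d + g w d); first exact: nestedD.
by move=> t d; rewrite big_cons Pi fg fh.
Qed.

Let at_newton_term I n : (0 < n)%N ->
  at_newton true I n (fun t d => zeta_term CI t d I n).
Proof.
have [N IN] : exists N, (#|I| <= N)%N by exists #|I|.
elim: N => [|N IH] in I n IN * => n0.
  have -> : I = finset.set0 by apply/eqP; rewrite -cards_eq0 -leqn0.
  exists (fun w d => weight_term CI w d finset.set0 n); first exact: nested_term.
  by move=> t d; rewrite weight_term0 zeta_term0.
have [->|[k kI]] := finset.set_0Vmem I; first by apply: IH; rewrite ?cards0.
have kI' : k \notin I :\ k by rewrite !inE eqxx.
have I'N : (#|I :\ k| <= N)%N by have := cardsD1 k I; rewrite kI; lia.
have dk : [disjoint [set k] & I :\ k] by rewrite disjoints1.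
rewrite -{1}(finset.setD1K kI).
have [g ng fg] := IH _ _ I'N n0.
have [h nh fh] : at_newton true (k |: I :\ k) n (fun t d => \sum_(j < n | (q ^ j < n)%N)
    tail (newton_weight t) k j d * zeta_term CI t d (I :\ k) (n - q ^ j)).
  apply: at_newton_big => j jn.
  have [|h nh fh] := IH (I :\ k) (n - q ^ j)%N I'N; first by rewrite subn_gt0.
  exists (fun w d => h w d * tail w k j d); last by move=> t d; rewrite fh mulrC.
  rewrite disjoint_sym in dk.
  apply: nested_eq (wnestedM_lead dk nh (nested_tail k j)) _ _ _ => //.
    by rewrite finset.setUC.
  by rewrite subnK // ltnW.
exists (fun w d => \prod_(l in [set k]) w l d * g w d + h w d).
  exact: nestedD (nested_weight dk ng) nh.
move=> t d.
have -> : zeta_term CI t d I n = zeta_term CI t d (k |: I :\ k) n.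
  by rewrite finset.setD1K.
by rewrite zeta_term_rec ?(cardIq kI') // big_set1 fg fh.
Qed.

(** By [zeta_term_rec], a zeta term is a weighted term plus terms with fewer
    variables. *)
Lemma znested_newton b X n f : znested b X n f ->
  exists2 g, wnested b X n g & forall t d, f t d = g (newton_weight t) d.
Proof.
elim=> {b X n f} [b X n|b X n k f f' _ [g ng fg] _ [g' ng' fg']
  ||X n f _ [g ng fg]|I J m n f dIJ m0 _ [g ng fg]].
- by exists (fun _ _ => 0) => //; exact: nested_0.
- exists (fun w d => emb CI k * g w d + g' w d); first exact: nested_lin.
  by move=> t d; rewrite fg fg'.
- by exists (fun _ _ => 1) => //; exact: nested_1.
- exists (fun w D => \sum_(d < D) g w d); first exact: nested_sum.
  by move=> t d; apply: eq_bigr => i _.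
have [h nh fh] := at_newton_term I m0.
exists (fun w d => h w d * g w d); first exact: wnestedM_lead.
by move=> t d; rewrite fg fh.
Qed.

(* [zeta_term_rec] read from right to left moves the variables in [Y] one by one
   into the zeta term, up to terms of smaller weight. *)
Let newton_term N :
  (forall X n g, (n < N)%N -> wnested false X n g ->
     znested false X n (fun t d => g (newton_weight t) d)) ->
  forall m Y I, (0 < m <= N)%N -> [disjoint Y & I] ->
  znested true (Y :|: I) m
    (fun t d => \prod_(k in Y) newton CI d (t k) * zeta_term CI t d I m).
Proof.
move=> lowN; elim/ltn_ind => m IHm Y I /andP[m0 mN].
have [M YM] : exists M, (#|Y| <= M)%N by exists #|Y|.
elim: M => [|M IHM] in Y I YM * => dYI.
  have Y0 : Y = finset.set0 by apply/eqP; rewrite -cards_eq0 -leqn0.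
  have := nested_term (emb CI) (zeta_term CI (V := V)) I m0.
  by rewrite Y0 finset.set0U; apply: nested_ext => t d; rewrite big_set0 mul1r.
have [Y0|[k kY]] := finset.set_0Vmem Y; first by apply: IHM; rewrite ?Y0 ?cards0 -?Y0.
have YE := finset.setD1K kY.
have kY' : k \notin Y :\ k by rewrite !inE eqxx.
have Y'M : (#|Y :\ k| <= M)%N by have := cardsD1 k Y; rewrite kY; lia.
move: dYI; rewrite -{1}YE disjointU3 disjoints1 => /andP[kI dYI].
have dYk : [disjoint Y :\ k & [set k]] by rewrite disjoint_sym disjoints1.
have n1 : znested true (Y :|: I) m (fun t d =>
    \prod_(l in Y :\ k) newton CI d (t l) * zeta_term CI t d (k |: I) m).
  have := IHM (Y :\ k) (k |: I) Y'M; rewrite disjoint3U dYI dYk => /(_ isT) nI.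
  apply: nested_eq nI _ _ _ => //.
  by rewrite -[in RHS]YE finset.setUA [_ :|: [set k]]finset.setUC.
have n2 (j : 'I_m) : (q ^ j < m)%N -> znested true (Y :|: I) m (fun t d =>
    \prod_(l in Y :\ k) newton CI d (t l) * zeta_term CI t d I (m - q ^ j) *
    tail (newton_weight t) k j d).
  move=> jm; have qj : (0 < q ^ j)%N by rewrite expn_gt0 (ltnW (@q_gt1 F)).
  have nI := IHm (m - q ^ j)%N _ (Y :\ k) I _ dYI.
  have nt := lowN _ _ _ (leq_trans jm mN) (nested_tail k j).
  have := znestedM_lead (Y := [set k]) _ (nI _ _) nt.
  rewrite disjointU3 dYk [[disjoint I & _]]disjoint_sym disjoints1 kI.
  move=> /(_ isT) nM; apply: nested_eq (nM _ _) _ _ _ => //; try lia.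
  by rewrite -[in RHS]YE [_ :|: [set k]]finset.setUC finset.setUA.
have n3 := nested_big (index_enum _) n2.
apply: nested_ext (nestedB n1 n3) => t d; cbv beta.
rewrite zeta_term_rec ?(cardIq kI) // mulrDr -[in RHS]YE big_setU1 //=.
rewrite -addrA [X in _ + (X - _)]mulr_sumr -sumrB [X in _ + X]big1 => [|j _].
  by rewrite addr0 mulrCA mulrA.
by rewrite [tail _ _ _ _ * _]mulrC mulrA subrr.
Qed.

(** The converse of [znested_newton], by induction on the weight. *)
Lemma wnested_newton b X n g : wnested b X n g ->
  znested b X n (fun t d => g (newton_weight t) d).
Proof.
elim/ltn_ind: n => n IHn in b X g *.
have low : forall X' n' g', (n' < n)%N -> wnested false X' n' g' ->
     znested false X' n' (fun t d => g' (newton_weight t) d).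
  by move=> X' n' g' n'n; exact: IHn.
move=> ng; elim: ng low => {b X n g IHn} [b X n _|b X n k g h _ IHg _ IHh low|_
  |X n g _ IHg low|I J m n g dIJ m0 ng _ low].
- exact: nested_0.
- exact: nested_lin (IHg low) (IHh low).
- exact: nested_1.
- exact: nested_sum (IHg low).
have nI : znested true I m (fun t d => weight_term CI (newton_weight t) d I m).
  have := newton_term (N := (m + n)%N) low (m := m) (Y := I) (I := finset.set0).
  rewrite m0 leq_addr -finset.setI_eq0 finset.setI0 eqxx => /(_ isT isT) nI.
  apply: nested_eq nI _ _ _ => [|//|t d]; first by rewrite finset.setU0.
  by rewrite zeta_term0 mulrC.
by apply: znestedM_lead dIJ nI (low _ _ _ _ ng); lia.
Qed.

End Exchange.

(** * Absolute values and convergence *)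

Section AbsoluteValue.
Context (R : realType) (F : finFieldType) (C : fieldType) (CI : Cinfty R F C).

Local Notation q := #|F|.
Local Notation ev := (evt CI).
Local Notation vab := (vabs CI).
Local Notation wt := (lagrange_wt CI).
Implicit Types (u : nat -> C).

Lemma prodr_ge1 (I : Type) (r : seq I) (P : pred I) (f : I -> R) :
  (forall i, P i -> 1 <= f i) -> 1 <= \prod_(i <- r | P i) f i.
Proof. by move=> f1; elim/big_ind: _ => // x y; exact: mulr_ege1. Qed.

Lemma vabs1 : vab 1 = 1.
Proof.
have := vabs_poly CI (oner_neq0 {poly F}).
by rewrite -[emb CI _]/(ev 1) rmorph1 size_poly1 expr0.
Qed.

Lemma vabsX x n : vab (x ^+ n) = vab x ^+ n.
Proof.
by elim: n => [|n IH]; rewrite ?expr0 ?vabs1 // !exprS vabsM IH.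
Qed.

Lemma vabsN x : vab (- x) = vab x.
Proof.
rewrite -mulN1r vabsM; suff -> : vab (-1) = 1 by rewrite mul1r.
have /eqP := vabsX (-1) 2; rewrite sqrrN expr1n vabs1 eq_sym sqrf_eq1.
by case/orP => /eqP // e; have := vabs_ge0 CI (-1); rewrite e oppr_ge0 ler10.
Qed.

Lemma vabsV x : vab x^-1 = (vab x)^-1.
Proof.
have [->|x0] := eqVneq x 0; first by rewrite invr0 vabs0 invr0.
have x1 : vab x * vab x^-1 = 1 by rewrite -vabsM divff ?vabs1.
have v0 : vab x != 0 by apply: contra_eq_neq x1 => ->; rewrite mul0r eq_sym oner_neq0.
by apply: (mulfI v0); rewrite x1 divff.
Qed.

Lemma vabs_prod (I : Type) (r : seq I) (P : pred I) (f : I -> C) :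
  vab (\prod_(i <- r | P i) f i) = \prod_(i <- r | P i) vab (f i).
Proof. by apply: (big_morph vab (vabsM CI) vabs1). Qed.

Lemma vabsD_le x y B : vab x <= B -> vab y <= B -> vab (x + y) <= B.
Proof.
by move=> xB yB; apply: le_trans (vabs_ultra CI x y) _; rewrite ge_max xB.
Qed.

Lemma vabsB_le x y B : vab x <= B -> vab y <= B -> vab (x - y) <= B.
Proof. by move=> xB yB; apply: vabsD_le => //; rewrite vabsN. Qed.

Lemma vabs_sum_le (I : Type) (r : seq I) (P : pred I) (f : I -> C) B :
  0 <= B -> (forall i, P i -> vab (f i) <= B) ->
  vab (\sum_(i <- r | P i) f i) <= B.
Proof.
move=> B0 fB; elim/big_ind: _ => // [|x y]; first by rewrite vabs0.
exact: vabsD_le.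
Qed.

Lemma vcvgP u l : vcvg vab u l <->
  forall e : R, 0 < e -> exists N, forall n, (N <= n)%N -> vab (u n - l) < e.
Proof.
split=> [ul e e0|ul].
  have /cvgrPdist_lt/(_ e e0) [N _ NP] := ul; exists N => n Nn.
  have := NP n Nn; rewrite /= sub0r normrN ger0_norm //; exact: vabs_ge0.
apply/cvgrPdist_lt => e /ul [N NP]; exists N => // n Nn.
by rewrite /= sub0r normrN ger0_norm ?NP // vabs_ge0.
Qed.

Lemma vcvg_uniq u l l' : vcvg vab u l -> vcvg vab u l' -> l = l'.
Proof.
move=> /vcvgP ul /vcvgP ul'; apply/eqP; rewrite -subr_eq0.
apply/eqP/(vabs_eq0 (c := CI)).
apply/eqP; rewrite eq_le vabs_ge0 andbT leNgt; apply/negP => e0.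
have [N NP] := ul _ e0; have [N' NP'] := ul' _ e0.
have := NP _ (leq_maxl N N'); have := NP' _ (leq_maxr N N') => a b.
have : vab (u (maxn N N') - l' - (u (maxn N N') - l)) < vab (l - l').
  by apply: le_lt_trans (vabs_ultra CI _ _) _; rewrite vabsN gt_max a.
have -> : u (maxn N N') - l' - (u (maxn N N') - l) = l - l' by ring.
by rewrite ltxx.
Qed.

Lemma vcvg_lim u l : vcvg vab u l -> vlim vab u = l.
Proof.
by move=> ul; apply: (vcvg_uniq _ ul); rewrite /vlim; apply: (@xgetI _ _ _ l).
Qed.

Lemma eq_vcvg u u' l : (forall n, u n = u' n) -> vcvg vab u l -> vcvg vab u' l.
Proof. by move=> uu; suff -> : u = u' by []; apply/funext. Qed.

Lemma vcvg_cst c : vcvg vab (fun _ => c) c.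
Proof. by apply/vcvgP => e e0; exists 0%N => n _; rewrite subrr vabs0. Qed.

Lemma vcvgD u u' l l' : vcvg vab u l -> vcvg vab u' l' ->
  vcvg vab (fun n => u n + u' n) (l + l').
Proof.
move=> /vcvgP ul /vcvgP ul'; apply/vcvgP => e e0.
have [N NP] := ul _ e0; have [N' NP'] := ul' _ e0.
exists (maxn N N') => n; rewrite geq_max => /andP[Nn N'n].
rewrite opprD addrACA; apply: le_lt_trans (vabs_ultra CI _ _) _.
by rewrite gt_max NP // NP'.
Qed.

Lemma vcvg_bounded u l : vcvg vab u l -> exists2 B, 0 < B & forall n, vab (u n) <= B.
Proof.
move=> /vcvgP /(_ 1 ltr01) [N NP].
exists (1 + vab l + \sum_(i < N) vab (u i)).
  by rewrite -addrA ltr_pwDl // addr_ge0 ?vabs_ge0 // sumr_ge0 // => i _; exact: vabs_ge0.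
move=> n; case: (ltnP n N) => [nN|/NP nN].
  rewrite (bigD1 (Ordinal nN)) //= addrCA lerDl.
  by rewrite !addr_ge0 ?vabs_ge0 // sumr_ge0 // => i _; exact: vabs_ge0.
rewrite -[u n](subrK l); apply: le_trans (vabs_ultra CI _ _) _.
have S0 : 0 <= \sum_(i < N) vab (u i) by apply: sumr_ge0 => i _; exact: vabs_ge0.
have l0 := vabs_ge0 CI l; have ln := vabs_ge0 CI (u n - l).
by rewrite ge_max; apply/andP; split; lra.
Qed.

Lemma vcvg0_dom u (r : nat -> R) B : (r @ \oo --> (0 : R))%classic ->
  (forall n, vab (u n) <= B * r n) -> vcvg vab u 0.
Proof.
move=> r0 ur; rewrite /vcvg.
have Br : ((fun n => B * r n) @ \oo --> (0 : R))%classic.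
  by rewrite -(mulr0 B); apply: cvgM => //; exact: cvg_cst.
apply: (squeeze_cvgr _ (cvg_cst 0) Br); near=> n.
by rewrite subr0 vabs_ge0 ur.
Unshelve. all: by end_near. Qed.

Lemma vcvg0M u u' l : vcvg vab u 0 -> vcvg vab u' l -> vcvg vab (fun n => u n * u' n) 0.
Proof.
move=> u0 /vcvg_bounded [B B0 uB].
apply: (@vcvg0_dom _ (fun n => vab (u n)) B).
  apply: cvg_trans u0; apply: near_eq_cvg; near=> n; by rewrite subr0.
by move=> n; rewrite vabsM mulrC ler_wpM2r ?vabs_ge0.
Unshelve. all: by end_near. Qed.

Lemma vcvgM u u' l l' : vcvg vab u l -> vcvg vab u' l' ->
  vcvg vab (fun n => u n * u' n) (l * l').
Proof.
move=> ul ul'.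
have ul0 : vcvg vab (fun n => u n - l) 0.
  by have := vcvgD ul (vcvg_cst (- l)); rewrite subrr.
have ul0' : vcvg vab (fun n => u' n - l') 0.
  by have := vcvgD ul' (vcvg_cst (- l')); rewrite subrr.
have a := vcvg0M ul0 ul'; have b := vcvg0M ul0' (vcvg_cst l).
have := vcvgD (vcvgD a b) (vcvg_cst (l * l')); rewrite !add0r.
by apply: eq_vcvg => n; ring.
Qed.

Lemma vcvg_sum (I : Type) (r : seq I) (P : pred I) (u : I -> nat -> C) (l : I -> C) :
  (forall i, P i -> vcvg vab (u i) (l i)) ->
  vcvg vab (fun n => \sum_(i <- r | P i) u i n) (\sum_(i <- r | P i) l i).
Proof.
move=> ul; elim: r => [|i r IH].
  by rewrite big_nil; apply: eq_vcvg (vcvg_cst 0) => n; rewrite big_nil.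
rewrite big_cons; case Pi: (P i).
  by apply: eq_vcvg (vcvgD (ul i Pi) IH) => n; rewrite big_cons Pi.
by apply: eq_vcvg IH => n; rewrite big_cons Pi.
Qed.

Lemma vcvg_series u : vcvg vab u 0 -> exists l, vcvg vab (fun D => \sum_(d < D) u d) l.
Proof.
move=> /vcvgP u0; apply: (vcomplete (c := CI)) => e e0.
have [N NP] := u0 _ (divr_gt0 e0 (ltr0Sn R 1)); exists N.
have tail m : (N <= m)%N ->
    vab (\sum_(d < m) u d - \sum_(d < N) u d) <= e / 2.
  move=> Nm; rewrite -!(big_mkord xpredT u) (@big_cat_nat _ _ _ N) //= addrAC subrr add0r.
  rewrite big_nat_cond; apply: vabs_sum_le; first by rewrite ltW // divr_gt0.
  by move=> d /andP[/andP[Nd _] _]; have := NP d Nd; rewrite subr0 => /ltW.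
move=> m n Nm Nn; apply: (@le_lt_trans _ _ (e / 2)); last by lra.
have -> : \sum_(d < m) u d - \sum_(d < n) u d =
  (\sum_(d < m) u d - \sum_(d < N) u d) - (\sum_(d < n) u d - \sum_(d < N) u d) by ring.
by apply: vabsB_le; exact: tail.
Qed.

Lemma vabs_lagrange_wt_le1 i j : vab (wt i j) <= 1.
Proof.
rewrite /lagrange_wt; case: ifP => _; last by rewrite vabs0.
rewrite vabsV invf_le1.
  rewrite vabs_prod; apply: prodr_ge1 => k kj.
  rewrite /node /theta -!rmorphXn -rmorphB; apply: vabs_poly_ge1.
  rewrite subr_eq0; apply: contra kj => /eqP /(congr1 (fun p : {poly F} => size p)).
  rewrite !size_polyXn => -[] /eqP; rewrite eqn_exp2l ?q_gt1 //.
  by rewrite eq_sym.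
rewrite vabs_prod; apply: prodr_gt0 => k kj.
rewrite lt_neqAle vabs_ge0 andbT eq_sym.
apply: contra kj => /eqP/(vabs_eq0 (c := CI))/eqP.
by rewrite subr_eq0 => /eqP/node_inj ->.
Qed.

(** The absolute value of [1 / l_d]. *)
Definition ell d : R := vab (wt d 0).

(** In [power_sum_rec] the Lagrange weights have absolute value at most [1]. *)
Lemma vabs_power_sum d n : (0 < n)%N -> vab (power_sum CI d n) <= ell d.
Proof.
elim/ltn_ind: n => -[|[_ _|n IH _]] //; first by rewrite power_sum1.
rewrite power_sum_rec //; apply: vabs_sum_le; first exact: vabs_ge0.
move=> j jn; rewrite vabsM -[X in _ <= X]mul1r.
apply: ler_pM; rewrite ?vabs_ge0 ?vabs_lagrange_wt_le1 //.
have qj : (0 < q ^ j)%N by rewrite expn_gt0 ltnW ?q_gt1.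
by apply: IH; lia.
Qed.

Definition node_abs j : R := q%:R ^+ (q ^ j).

Lemma vabs_node j : vab (node CI j) = node_abs j.
Proof.
rewrite /node /theta -rmorphXn vabs_poly ?size_polyXn //.
by rewrite -size_poly_eq0 size_polyXn.
Qed.

Lemma node_abs_ge1 j : 1 <= node_abs j.
Proof. by apply: exprn_ege1; rewrite ler1n ltnW ?q_gt1. Qed.

Lemma vabs_node0B j : (0 < j)%N -> vab (node CI 0 - node CI j) = node_abs j.
Proof.
move=> j0; rewrite -vabsN opprB.
rewrite /node /theta -!rmorphXn -rmorphB /= expn0 expr1.
have q1 : (1 < q ^ j)%N.
  by rewrite -(exp1n j) ltn_exp2r ?q_gt1.
have sz : size ('X^(q ^ j) - 'X : {poly F}) = (q ^ j).+1.
  by rewrite size_polyDl size_polyXn // size_polyN size_polyX ltnS.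
by rewrite vabs_poly ?sz // -size_poly_eq0 sz.
Qed.

Lemma ellE d : ell d = \prod_(j < d) (node_abs j ^+ q)^-1.
Proof.
rewrite /ell /lagrange_wt /= vabsV vabs_prod big_mkcond big_ord_recl /= mul1r.
rewrite prodfV; congr (_^-1); apply: eq_bigr => j _.
by rewrite vabs_node0B // /node_abs -exprM -expnSr.
Qed.

Lemma ell_ge0 d : 0 <= ell d.
Proof. exact: vabs_ge0. Qed.

Lemma ell_le d D : (d <= D)%N -> ell D <= ell d.
Proof.
move=> dD; rewrite -(subnKC dD); elim: (D - d)%N => [|k IH]; first by rewrite addn0.
rewrite addnS ellE big_ord_recr /= -ellE; apply: le_trans IH.
rewrite -[X in _ <= X]mulr1 ler_wpM2l ?ell_ge0 // invf_le1.
  exact/exprn_ege1/node_abs_ge1.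
by rewrite exprn_gt0 // (lt_le_trans ltr01) ?node_abs_ge1.
Qed.

Definition newton_bound (M : R) d : R := \prod_(j < d) Num.max M (node_abs j).

Lemma newton_bound_ge1 M d : 1 <= newton_bound M d.
Proof. by apply: prodr_ge1 => j _; rewrite le_max node_abs_ge1 orbT. Qed.

Lemma newton_bound_le M d D : (d <= D)%N -> newton_bound M d <= newton_bound M D.
Proof.
move=> dD; rewrite -(subnKC dD); elim: (D - d)%N => [|k IH]; first by rewrite addn0.
rewrite addnS /newton_bound big_ord_recr /=; apply: (le_trans IH).
rewrite -[X in X <= _]mulr1 ler_wpM2l ?le_max ?node_abs_ge1 ?orbT //.
by rewrite (le_trans ler01) ?newton_bound_ge1.
Qed.

Lemma vabs_newton M t d : vab t <= M -> vab (newton CI d t) <= newton_bound M d.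
Proof.
move=> tM; rewrite /newton vabs_prod; apply: ler_prod => j _.
rewrite vabs_ge0 /=; apply: le_trans (vabs_ultra CI _ _) _.
by rewrite vabsN vabs_node ge_max !le_max tM lexx orbT.
Qed.

Lemma cvg0_halving (u : nat -> R) N : (forall n, 0 <= u n) ->
  (forall n, (N <= n)%N -> u n.+1 <= u n / 2) -> (u @ \oo --> (0 : R))%classic.
Proof.
move=> u0 uS; apply/cvgrPdist_lt => e e0.
have uk k : u (N + k)%N * k.+1%:R <= u N.
  elim: k => [|k IH]; first by rewrite addn0 mulr1.
  apply: le_trans IH; rewrite addnS.
  have := uS (N + k)%N (leq_addr _ _); have := u0 (N + k)%N.
  have : (0 : R) <= k%:R by [].
  rewrite -[k.+2%:R]natr1 -![k.+1%:R]natr1; 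
  move: (u (N + k).+1) (u (N + k)%N) k%:R => a b c c0 b0 ab.
  have : 0 <= (b / 2 - a) * (c + 2) by apply: mulr_ge0; lra.
  by have := mulr_ge0 b0 c0; lra.
pose K := Num.truncn (u N / e).
exists (N + K)%N => // n /= Nn; rewrite sub0r normrN ger0_norm //.
have [k nE] : exists k, n = (N + k)%N by exists (n - N)%N; lia.
have Kk : (K <= k)%N by lia.
have : u N / e < k.+1%:R.
  apply: lt_le_trans (truncnS_gt _) _; by rewrite ler_nat ltnS.
rewrite ltr_pdivrMr // nE => uNe; have := uk k => ukN.
have k0 : (0 : R) < k.+1%:R by [].
rewrite -(ltr_pM2r k0); apply: (le_lt_trans ukN); by rewrite mulrC.
Qed.

(** For [j] large, the factors of [newton_bound ^ s] are [q ^ (s q ^ j)], while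
    those of [1 / ell] are [q ^ (q q ^ j)]. *)
Lemma newton_bound_ell M s : (s < q)%N ->
  ((fun d => newton_bound M d ^+ s * ell d) @ \oo --> (0 : R))%classic.
Proof.
move=> sq; pose N := (Num.truncn `|M|).+1.
have nb0 d : 0 <= newton_bound M d by rewrite (le_trans ler01) ?newton_bound_ge1.
apply: (@cvg0_halving _ N) => [n|n Nn]; first by rewrite mulr_ge0 ?ell_ge0 ?exprn_ge0.
have na0 : 0 < node_abs n by rewrite (lt_le_trans ltr01) ?node_abs_ge1.
have qn : (n < q ^ n)%N by rewrite ltn_expl ?q_gt1.
have nan : n.+1%:R <= node_abs n.
  rewrite /node_abs -natrX ler_nat; apply: (leq_trans qn).
  by apply: ltnW; rewrite ltn_expl ?q_gt1.
have Mn : M <= node_abs n.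
  apply: le_trans nan; apply: le_trans (ler_norm M) _; apply: ltW.
  apply: lt_le_trans (truncnS_gt _) _; rewrite ler_nat.
  exact: leq_trans Nn (leqnSn n).
rewrite /newton_bound ellE !big_ord_recr /= -/(newton_bound M n) -ellE.
rewrite (max_idPr Mn) exprMn mulrACA ler_wpM2l ?mulr_ge0 ?exprn_ge0 ?ell_ge0 //.
have -> : node_abs n ^+ s / node_abs n ^+ q = (node_abs n ^+ (q - s))^-1.
  by rewrite expf_div ?gt_eqF // sq.
rewrite lef_pV2 ?posrE ?exprn_gt0 //.
have [k ->] : exists k, (q - s)%N = k.+1 by exists (q - s).-1; lia.
rewrite exprS -[X in X <= _]mulr1 ler_pM //.
  apply: le_trans (_ : (q ^ q ^ n)%:R <= _); last by rewrite natrX.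
  rewrite ler_nat; apply: (@leq_trans q); first exact: q_gt1.
  by rewrite -{1}[q]expn1 leq_exp2l ?q_gt1 // expn_gt0 ltnW ?q_gt1.
  exact/exprn_ege1/node_abs_ge1.
by rewrite ltr0n ltnW ?q_gt1.
Qed.

End AbsoluteValue.

(** * Weighted sums as functions of the weights *)

Section WeightedSums.
Context (R : realType) (F : finFieldType) (C : fieldType) (CI : Cinfty R F C).
Context (V : finType).
Implicit Types (I J X Y : {set V}) (t : V -> C) (w : V -> nat -> C).
Implicit Types (h g : (V -> nat -> C) -> nat -> C).

Local Notation q := #|F|.
Local Notation vab := (vabs CI).
Local Notation wnested := (nested (emb CI) (weight_term CI (V := V))).

(** The shape of the truncated nested sums as functions of the weights: sums of
    monomials with one factor [w k d], [d < B], for each [k] in [X]. *)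
Inductive multilinear X B : ((V -> nat -> C) -> C) -> Prop :=
| multilinear_0 : multilinear X B (fun _ => 0)
| multilinear_lin c G H : multilinear X B G -> multilinear X B H ->
    multilinear X B (fun w => c * G w + H w)
| multilinear_prod (e : V -> nat) : (forall k, k \in X -> (e k < B)%N) ->
    multilinear X B (fun w => \prod_(k in X) w k (e k)).

Lemma multilinear_ext X B G H :
  (forall w, G w = H w) -> multilinear X B G -> multilinear X B H.
Proof. by move=> GH; suff -> : G = H by []; apply/funext. Qed.

Lemma multilinearZ X B c G : multilinear X B G -> multilinear X B (fun w => c * G w).
Proof.
move=> mG; apply: multilinear_ext (multilinear_lin c mG (multilinear_0 X B)) => w.
by rewrite addr0.
Qed.

Lemma multilinear_le X B B' G : (B <= B')%N -> multilinear X B G -> multilinear X B' G.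
Proof.
move=> BB; elim=> [|c {}G H _ mG _ mH|e eB]; first exact: multilinear_0.
  exact: multilinear_lin.
by apply: multilinear_prod => k kX; apply: leq_trans BB; exact: eB.
Qed.

Lemma multilinear_sum X B n (G : nat -> (V -> nat -> C) -> C) :
  (forall d, (d < n)%N -> multilinear X B (G d)) ->
  multilinear X B (fun w => \sum_(d < n) G d w).
Proof.
elim: n => [|n IH] mG.
  by apply: multilinear_ext (multilinear_0 X B) => w; rewrite big_ord0.
have mn := IH (fun d dn => mG d (ltnW dn)).
apply: multilinear_ext (multilinear_lin 1 (mG n (leqnn _)) mn) => w.
by rewrite mul1r big_ord_recr addrC.
Qed.

Lemma multilinear_weight I J B d G : [disjoint I & J] -> (d < B)%N ->
  multilinear J B G -> multilinear (I :|: J) B (fun w => \prod_(k in I) w k d * G w).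
Proof.
move=> dIJ dB; elim=> [|c {}G H _ mG _ mH|e eB].
- by apply: multilinear_ext (multilinear_0 _ _) => w; rewrite mulr0.
- apply: multilinear_ext (multilinear_lin c mG mH) => w.
  by rewrite mulrDr mulrCA.
have := @multilinear_prod (I :|: J) B (fun k => if k \in I then d else e k).
have eB' k : k \in I :|: J -> ((if k \in I then d else e k) < B)%N.
  by rewrite !inE; case: ifP => //= _; exact: eB.
move=> /(_ eB'); apply: multilinear_ext => w.
rewrite (eq_bigl [predU I & J]) => [|k]; last by rewrite !inE.
rewrite bigU //=; congr (_ * _); apply: eq_bigr => k kI; first by rewrite kI.
by rewrite (disjointFl dIJ kI).
Qed.

Lemma wnested_multilinear b X n g : wnested b X n g ->
  forall d, multilinear X (if b then d.+1 else d) (g^~ d).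
Proof.
elim=> {b X n g} [b X n|b X n k g h _ IHg _ IHh||X n g _ IHg|I J m n h dIJ m0 _ IHh] d.
- exact: multilinear_0.
- by apply: multilinear_ext (multilinear_lin (emb CI k) (IHg d) (IHh d)).
- have := @multilinear_prod finset.set0 d (fun _ => 0%N).
  have e0 k : k \in @finset.set0 V -> (0 < d)%N by rewrite inE.
  by move=> /(_ e0); apply: multilinear_ext => w; rewrite big_set0.
- apply: (@multilinear_sum X d d (fun e => g^~ e)) => e ed.
  exact: multilinear_le (IHg e).
have := multilinear_weight dIJ (leqnn d.+1) (multilinear_le (leqnSn d) (IHh d)).
move=> /(multilinearZ (power_sum CI d m)); apply: multilinear_ext => w.
by rewrite mulrA.
Qed.

Lemma multilinear_expand B G N (a : V -> 'I_N -> C) (u : V -> 'I_N -> nat -> C) w :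
  multilinear [set: V] B G ->
  (forall k d, (d < B)%N -> w k d = \sum_(j < N) a k j * u k j d) ->
  G w = \sum_(j : {ffun V -> 'I_N}) (\prod_k a k (j k)) * G (fun k => u k (j k)).
Proof.
move=> mG wE; elim: mG => [|c {}G H _ -> _ ->|e eB].
- by rewrite big1 // => j _; rewrite mulr0.
- rewrite mulr_sumr -big_split; apply: eq_bigr => j _ /=.
  by rewrite mulrDr mulrCA.
rewrite (eq_bigl xpredT) => [|k]; last by rewrite inE.
under eq_bigr => k _ do rewrite wE ?eB ?inE //.
rewrite bigA_distr_bigA /=; apply: eq_bigr => j _; rewrite big_split /=.
by congr (_ * _); apply: eq_bigl => k; rewrite inE.
Qed.

Definition null_weight w : Prop :=
  forall I m, (0 < m)%N -> vcvg vab (fun d => weight_term CI w d I m) 0.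

Lemma wnested_cvg b X n g w : wnested b X n g -> null_weight w ->
  exists2 l, vcvg vab (g w) l & b -> l = 0.
Proof.
move=> ng w0; elim: ng => {b X n g} [b X n|b X n k g h _ [l gl l0] _ [l' hl l0']
  ||X n g _ [l gl l0]|I J m n h dIJ m0 _ [l hl _]].
- by exists 0 => //; exact: vcvg_cst.
- exists (emb CI k * l + l').
    exact: vcvgD (vcvgM (vcvg_cst CI _) gl) hl.
  by move=> bT; rewrite l0 ?l0' // mulr0 addr0.
- by exists 1 => //; exact: vcvg_cst.
- rewrite l0 // in gl; have [l1 gl1] := vcvg_series gl.
  by exists l1.
by exists 0 => //; exact: vcvg0M (w0 I m m0) hl.
Qed.

Definition small_weight w : Prop := forall k d, vab (w k d) <= 1.

Lemma vabs_weight_term w d I m : (0 < m)%N -> small_weight w ->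
  vab (weight_term CI w d I m) <= ell CI d.
Proof.
move=> m0 w1; rewrite vabsM -[X in _ <= X]mulr1 ler_pM ?vabs_ge0 ?vabs_power_sum //.
rewrite vabs_prod; apply: (@le_trans _ _ (\prod_(k in I) (1 : R))); last by rewrite big1.
by apply: ler_prod => k _; rewrite vabs_ge0 w1.
Qed.

Lemma ell_le1 d : ell CI d <= 1.
Proof. by have := ell_le CI (leq0n d); rewrite [ell CI 0]ellE big_ord0. Qed.

(** The terms of degree [e] are bounded by a multiple of [ell e]; as [ell] decreases
    and the absolute value is ultrametric, so is the part of the sum from degree
    [e] on. *)
Lemma wnested_bound b X n g : wnested b X n g ->
  exists2 M, 0 <= M & forall w, small_weight w -> forall d,
    vab (g w d) <= (if b then M * ell CI d else M) /\
    (b = false -> forall D, (d <= D)%N -> vab (g w D - g w d) <= M * ell CI d).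
Proof.
elim=> {b X n g} [b X n|b X n k g h _ [M M0 gM] _ [N N0 hN]
  ||X n g _ [M M0 gM]|I J m n h dIJ m0 _ [M M0 hM]].
- exists 0 => // w w1 d; rewrite subrr vabs0 mul0r; split=> //; by case: b.
- pose B := vab (emb CI k) * M + N.
  have k0 : 0 <= vab (emb CI k) * M by rewrite mulr_ge0 ?vabs_ge0.
  exists B => [|w w1 d]; first by rewrite addr_ge0.
  have e0 := ell_ge0 CI d; have [ga gb] := gM w w1 d; have [ha hb] := hN w w1 d.
  have NB : N <= B by rewrite /B lerDr.
  have MB : vab (emb CI k) * M <= B by rewrite /B lerDl.
  have comb x y r : 0 <= r -> vab x <= M * r -> vab y <= N * r ->
      vab (emb CI k * x + y) <= B * r.
    move=> r0 xr yr; apply: vabsD_le; last first.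
      by apply: le_trans yr _; rewrite ler_wpM2r.
    rewrite vabsM; apply: (@le_trans _ _ (vab (emb CI k) * (M * r))).
      by rewrite ler_wpM2l ?vabs_ge0.
    by rewrite mulrA ler_wpM2r.
  split=> [|b0 D dD].
    case: (b) ga ha => ga ha; first exact: comb.
    by rewrite -[B]mulr1; apply: comb; rewrite ?mulr1.
  rewrite (_ : _ - _ = emb CI k * (g w D - g w d) + (h w D - h w d)); last by ring.
  by apply: comb => //; [exact: gb | exact: hb].
- exists 1 => // w w1 d; rewrite subrr vabs0 vabs1 mul1r; split=> // _ D _.
  exact: ell_ge0.
- exists M => // w w1 d; split=> [|_ D dD].
    apply: vabs_sum_le => // e _; apply: le_trans (gM w w1 e).1 _.
    by rewrite -[X in _ <= X]mulr1 ler_wpM2l ?ell_le1.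
  rewrite -!(big_mkord xpredT (g w)) (@big_cat_nat _ _ _ d) //= addrAC subrr add0r.
  rewrite big_nat_cond; apply: vabs_sum_le; first by rewrite mulr_ge0 ?ell_ge0.
  move=> e /andP[/andP[de _] _]; apply: le_trans (gM w w1 e).1 _.
  by rewrite ler_wpM2l ?ell_le.
exists M => // w w1 d; split=> //; rewrite vabsM mulrC.
by apply: ler_pM; rewrite ?vabs_ge0 ?vabs_weight_term //; have [] := hM w w1 d.
Qed.

Definition delta_weight (i : V -> nat) : V -> nat -> C := fun k d => (d == i k)%:R.

Lemma small_delta_weight i : small_weight (delta_weight i).
Proof. by move=> k d; rewrite /delta_weight; case: eqP; rewrite ?vabs0 ?vabs1. Qed.

Lemma null_delta_weight i : null_weight (delta_weight i).
Proof.
move=> I m m0; apply: (@vcvg0_dom _ _ _ _ _ (ell CI) 1).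
  have := newton_bound_ell CI 1 (ltnW (q_gt1 F)).
  by under eq_fun do rewrite expr0 mul1r.
by move=> n; rewrite mul1r vabs_weight_term //; exact: small_delta_weight.
Qed.

Hypothesis Vq : (#|V| < q)%N.

Lemma vabs_le_sum t k : vab (t k) <= \sum_l vab (t l).
Proof. by rewrite (bigD1 k) //= lerDl sumr_ge0 // => l _; exact: vabs_ge0. Qed.

Lemma null_newton_weight t : null_weight (newton_weight CI t).
Proof.
move=> I m m0; pose M := \sum_l vab (t l).
apply: (vcvg0_dom (B := 1) (newton_bound_ell CI M Vq)) => d.
rewrite mul1r vabsM mulrC ler_pM ?vabs_ge0 ?vabs_power_sum //.
rewrite vabs_prod; apply: (@le_trans _ _ (\prod_(k in I) newton_bound F M d)).
  apply: ler_prod => k _; rewrite vabs_ge0 vabs_newton //; exact: vabs_le_sum.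
rewrite prodr_const; apply: ler_weXn2l; first exact: newton_bound_ge1.
exact: max_card.
Qed.

(** The weight [newton_weight t k] is the combination of the delta weights with
    the coefficients [b_i(t_k)]. *)
Lemma multilinear_newton G D t : multilinear [set: V] D G ->
  G (newton_weight CI t) =
  \sum_(i : {ffun V -> 'I_D}) (\prod_k newton CI (i k) (t k)) *
     G (delta_weight (fun k => i k)).
Proof.
move=> mG; apply: (multilinear_expand (a := fun k i => newton CI i (t k))
  (u := fun k i d => (d == i)%:R) mG) => k d dD.
rewrite (bigD1 (Ordinal dD)) //= eqxx mulr1 big1 ?addr0 // => j jd.
by rewrite (_ : (d == j :> nat) = false) ?mulr0 //; apply/negbTE; rewrite eq_sym.
Qed.

(** By [multilinear_newton] the truncation at [D] is a Newton polynomial in [t]. Its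
    coefficients have limit [0], hence are bounded by [M * ell D], and the products
    of Newton polynomials that they multiply are bounded by [newton_bound ^ #|V|];
    conclude by [newton_bound_ell]. *)
Lemma newton_limit0 h M t l :
  (forall D, multilinear [set: V] D (h^~ D)) -> 0 <= M ->
  (forall w, small_weight w -> forall d D, (d <= D)%N ->
     vab (h w D - h w d) <= M * ell CI d) ->
  (forall i : V -> nat, vcvg vab (h (delta_weight i)) 0) ->
  vcvg vab (h (newton_weight CI t)) l -> l = 0.
Proof.
move=> mh M0 hM h0 hl; apply: (vcvg_uniq hl).
pose T := \sum_k vab (t k).
have hd i D : vab (h (delta_weight i) D) <= M * ell CI D.
  have /vcvgP hi := h0 i; apply/ler_addgt0Pr => e e0.
  have [N NP] := hi e e0; have := NP _ (leq_maxl N D); rewrite subr0 => he.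
  have := hM _ (small_delta_weight i) _ _ (leq_maxr N D) => hm.
  rewrite -[h _ D]subr0 -[0](subrr (h (delta_weight i) (maxn N D))) opprB addrCA.
  have e1 : vab (h (delta_weight i) (maxn N D)) <= M * ell CI D + e.
    by rewrite (le_trans (ltW he)) // lerDr mulr_ge0 ?ell_ge0.
  apply: vabsD_le => //; rewrite -vabsN opprB (le_trans hm) // lerDl ltW //.
apply: (vcvg0_dom (B := M) (newton_bound_ell CI T Vq)) => D.
have nb0 : 0 <= newton_bound F T D by rewrite (le_trans ler01) ?newton_bound_ge1.
rewrite (multilinear_newton t (mh D)); apply: vabs_sum_le.
  by rewrite !mulr_ge0 ?ell_ge0 ?exprn_ge0.
move=> i _; rewrite vabsM [X in _ <= X]mulrCA; apply: ler_pM; rewrite ?vabs_ge0 //.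
rewrite vabs_prod -prodr_const; apply: ler_prod => k _; rewrite vabs_ge0 /=.
apply: le_trans (vabs_newton (i k) (vabs_le_sum t k)) _.
by apply: newton_bound_le; rewrite ltnW.
Qed.

End WeightedSums.

(** * Sums over decreasing families and composition arrays *)

Fixpoint iter_sum (C : nzRingType) (gs : seq (nat -> C)) (D : nat) : C :=
  if gs is g :: gs' then \sum_(d < D) g d * iter_sum gs' d else 1.

Lemma eq_iter_sum (C : nzRingType) (I : eqType) (s : seq I) (g g' : I -> nat -> C) D :
  (forall i d, i \in s -> (d < D)%N -> g i d = g' i d) ->
  iter_sum [seq g i | i <- s] D = iter_sum [seq g' i | i <- s] D.
Proof.
elim: s D => //= i s IH D gg; apply: eq_bigr => d _; rewrite gg ?mem_head //.
congr (_ * _); apply: IH => j e js ed; apply: gg; last exact: ltn_trans ed _.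
by rewrite inE js orbT.
Qed.

(** The value at [0] of a family is chosen first; the rank of this value bounds the
    ranks of the other ones. *)
Lemma sum_decreasing (C : comNzRingType) (I : Type) (T : finType) (r : T -> nat)
    (P : pred T) (s : seq I) (g : I -> T -> C) D :
  \sum_(a : {ffun 'I_(size s) -> T} |
     [&& [forall i, P (a i)],
         [forall i : 'I_(size s), forall j : 'I_(size s),
            (i < j)%N ==> (r (a j) < r (a i))%N] &
         [forall i, r (a i) < D]%N])
    \prod_(i < size s) g (tnth (in_tuple s) i) (a i) =
  iter_sum [seq (fun d => \sum_(x | P x && (r x == d)) g b x) | b <- s] D.
Proof.
elim: s D => [|b s IH] D /=.
  pose f0 : {ffun 'I_0 -> T} := [ffun i : 'I_0 => False_rect T (notF (ltn_ord i))].
  rewrite (big_pred1 f0); first by rewrite big_ord0.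
  move=> a; apply/idP/idP => _.
    by apply/eqP/ffunP; case.
  by apply/and3P; split; apply/forallP; case.
pose h (xa : T * {ffun 'I_(size s) -> T}) : {ffun 'I_(size s).+1 -> T} :=
  [ffun i => if unlift ord0 i is Some j then xa.2 j else xa.1].
pose k (f : {ffun 'I_(size s).+1 -> T}) := (f ord0, [ffun j => f (lift ord0 j)]).
have h0 xa : h xa ord0 = xa.1 by rewrite ffunE unlift_none.
have hS xa j : h xa (lift ord0 j) = xa.2 j by rewrite ffunE liftK.
have hk : cancel h k.
  by case=> x a; rewrite /k h0; congr (_, _); apply/ffunP => j; rewrite ffunE hS.
have kh : cancel k h.
  move=> f; apply/ffunP => i; rewrite ffunE; case: unliftP => [j|] ->//=.
  by rewrite ffunE.
rewrite (reindex h) /=; last by exists k => ? _.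
pose Q n := [pred a : {ffun 'I_(size s) -> T} | [&& [forall i, P (a i)],
         [forall i : 'I_(size s), forall j : 'I_(size s),
            (i < j)%N ==> (r (a j) < r (a i))%N] &
         [forall i, r (a i) < n]%N]].
transitivity (\sum_(xa : T * {ffun 'I_(size s) -> T} |
    (P xa.1 && (r xa.1 < D)%N) && Q (r xa.1) xa.2)
    g b xa.1 * \prod_(i < size s) g (tnth (in_tuple s) i) (xa.2 i)).
  apply: eq_big => [xa|xa _]; last first.
    rewrite big_ord_recl h0 (tnth_nth b) /=; congr (_ * _); apply: eq_bigr => i _.
    by rewrite hS !(tnth_nth b).
  apply/and3P/andP => [[/forallP Pa /forallP ra /forallP Da]|].
    have rS i : (r (xa.2 i) < r xa.1)%N.
      by have /forallP/(_ (lift ord0 i)) := ra ord0; rewrite h0 hS.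
    rewrite -[X in P X]h0 Pa -[X in (r X < D)%N]h0 Da; split=> //.
    apply/and3P; split; apply/forallP => i; first by have := Pa (lift ord0 i); rewrite hS.
      apply/forallP => j; have /forallP/(_ (lift ord0 j)) := ra (lift ord0 i).
      by rewrite !hS /= /bump !add1n ltnS.
    exact: rS.
  case=> /andP[Px rx] /and3P[/forallP Pa /forallP ra /forallP rS].
  split; apply/forallP => i.
  - by case: (unliftP ord0 i) => [j|] ->; rewrite ?h0 ?hS.
  - apply/forallP => j; case: (unliftP ord0 j) => [j'|] ->; last by rewrite ltn0.
    case: (unliftP ord0 i) => [i'|] ->; rewrite ?h0 !hS.
      by rewrite /= /bump !add1n ltnS; have /forallP := ra i'; apply.
    by rewrite rS implybT.
  - by case: (unliftP ord0 i) => [j|] ->; rewrite ?h0 ?hS // (ltn_trans (rS j)).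
rewrite -(pair_big_dep (fun x => P x && (r x < D)%N) (fun x => Q (r x))
  (fun x a => g b x * \prod_(i < size s) g (tnth (in_tuple s) i) (a i))) /=.
transitivity (\sum_(x | P x && (r x < D)%N)
    g b x * iter_sum [seq (fun d => \sum_(x | P x && (r x == d)) g b x) | b <- s] (r x)).
  by apply: eq_bigr => x _; rewrite -IH mulr_sumr.
under [RHS]eq_bigr do rewrite mulr_suml.
rewrite (exchange_big_dep P) /=; last by move=> d x _ /andP[].
rewrite big_mkcondr /=; apply: eq_bigr => x Px; rewrite Px /=.
case: ltnP => rD; last first.
  rewrite big_pred0 // => d; apply/negbTE; apply: contraL (ltn_ord d) => /eqP <-.
  by rewrite -leqNgt.
by rewrite (big_pred1 (Ordinal rD)).
Qed.

Section Arrays.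
Context (K C : fieldType) (em : {rmorphism K -> C}) (V : {fset npos}) (W : Type).
Variable S : W -> nat -> {set V} -> nat -> C.
Implicit Types (X : {set V}) (c : array).

Definition support_in (Sg : {mset npos}%mset) : {set V} :=
  [set x : V | (0 < Sg (val x))%N].

Definition mset_of X : {mset npos}%mset := seq_mset [seq val x | x <- enum X].

Lemma mset_ofE X (x : V) : mset_of X (val x) = (x \in X).
Proof.
rewrite mset_seqE count_uniq_mem; last by rewrite map_inj_uniq ?enum_uniq //; exact: val_inj.
by rewrite mem_map ?mem_enum //; exact: val_inj.
Qed.

Lemma mset_of_notin X (x : npos) : x \notin V -> mset_of X x = 0%N.
Proof.
move=> xV; rewrite mset_seqE; apply/count_memPn; apply: contra xV => /mapP [y _ ->].
exact: valP.
Qed.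

Lemma indicatorE (x : npos) : indicator V x = (x \in V).
Proof. by rewrite mset_seqE count_uniq_mem. Qed.

Lemma support_mset_of X : support_in (mset_of X) = X.
Proof. by apply/setP => x; rewrite inE mset_ofE lt0b. Qed.

Definition array_sum c (w : W) : nat -> C :=
  iter_sum [seq (fun d => S w d (support_in b.1) (val b.2)) | b <- c].

Definition array_lead c (w : W) (d : nat) : C :=
  if c is b :: c' then S w d (support_in b.1) (val b.2) * array_sum c' w d else 0.

Lemma array_nested c X : (forall x : V, (\sum_(b <- c) b.1 (val x))%N = (x \in X)) ->
  nested em S false X (\sum_(b <- c) val b.2) (array_sum c).
Proof.
elim: c X => [|b c IH] X cX.
  have -> : X = finset.set0.
    by apply/setP => x; have := cX x; rewrite big_nil inE; case: (x \in X).
  by rewrite big_nil; exact: nested_1.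
pose X' := [set x : V | (0 < \sum_(b <- c) b.1 (val x))%N].
have bc x : (b.1 (val x) + \sum_(b <- c) b.1 (val x))%N = (x \in X).
  by rewrite -cX big_cons.
have cX' x : (\sum_(b <- c) b.1 (val x))%N = (x \in X').
  rewrite inE; have := bc x; case: (x \in X) => /=; move: (\sum_(_ <- _) _)%N => n.
    by case: n => [|[|n]] //=; lia.
  by case: n => [|n] //=; lia.
have XE : X = support_in b.1 :|: X'.
  apply/setP => x; rewrite !inE; have := bc x; case: (x \in X) => /=; lia.
have dX : [disjoint support_in b.1 & X'].
  rewrite -finset.setI_eq0; apply/eqP/setP => x; rewrite !inE; have := bc x.
  case: (x \in X) => /=; lia.
rewrite XE big_cons; exact: nested_sum (nested_lead dX (valP b.2) (IH _ cX')).
Qed.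

Definition array_type c X n : Prop :=
  (forall x, (\sum_(b <- c) b.1 x)%N = mset_of X x) /\ (\sum_(b <- c) val b.2)%N = n.

(** Together with [array_nested], this identifies [nested] with the span of the sums
    attached to arrays. *)
Lemma nested_arrays b X n h : nested em S b X n h ->
  exists2 s : seq (K * array), (forall p, p \in s -> array_type p.2 X n) &
    forall w d, h w d = \sum_(p <- s) em p.1 *
      (if b then array_lead p.2 w d else array_sum p.2 w d).
Proof.
have strong : nested em S b X n h ->
  exists2 s : seq (K * array),
    (forall p, p \in s -> array_type p.2 X n /\ (b -> p.2 != [::])) &
    forall w d, h w d = \sum_(p <- s) em p.1 *
      (if b then array_lead p.2 w d else array_sum p.2 w d).
  elim=> {b X n h} [b X n|b X n k g h _ [s sP gE] _ [s' sP' hE]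
    ||X n g _ [s sP gE]|I J m n h dIJ m0 _ [s sP hE]].
  - by exists [::] => // w d; rewrite big_nil.
  - exists ([seq (k * p.1, p.2) | p <- s] ++ s').
      move=> p; rewrite mem_cat => /orP[/mapP [p' ps ->]|]; last exact: sP'.
      exact: sP p' ps.
    move=> w d; rewrite big_cat big_map /= gE hE mulr_sumr; congr (_ + _).
    by apply: eq_bigr => p _; rewrite rmorphM mulrA.
  - exists [:: (1, [::])] => [p|w d]; last by rewrite big_seq1 rmorph1 mul1r.
    rewrite inE => /eqP ->; split=> //; split=> [x|]; rewrite big_nil //.
    by rewrite /mset_of enum_set0 mset_seqE.
  - exists s => [p ps|w d]; first by have [] := sP p ps.
    under eq_bigr do rewrite gE.
    rewrite exchange_big /= !big_seq; apply: eq_bigr => p ps.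
    rewrite -mulr_sumr; congr (_ * _).
    by case: p ps => k [|b c] /sP [_ /(_ isT)].
  pose col : {mset npos}%mset * npos := (mset_of I, exist _ m m0).
  exists [seq (p.1, col :: p.2) | p <- s] => [p /mapP [p' /sP [[pJ pn] _] ->]|w d] /=.
    split=> //; split=> [x|]; rewrite big_cons; last by rewrite pn.
    rewrite pJ /=; case xV: (x \in V); last by rewrite !mset_of_notin ?xV.
    rewrite -[x]/(val (FSetSub xV)) !mset_ofE inE.
    case xI : (_ \in I) => //=; case xJ: (_ \in J) => //.
    by move: dIJ => /disjointFr /(_ xI); rewrite xJ.
  rewrite big_map hE mulr_sumr; apply: eq_bigr => p _ /=.
  by rewrite support_mset_of mulrCA.
move=> /strong [s sP hE]; exists s => // p ps; by have [] := sP p ps.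
Qed.

Lemma array_type_setT c n : array_type c [set: V] n <-> admissible (indicator V) n c.
Proof.
have E x : mset_of [set: V] x = indicator V x.
  rewrite indicatorE; case xV: (x \in V); last by rewrite mset_of_notin ?xV.
  by rewrite -[x]/(val (FSetSub xV)) mset_ofE inE.
by split=> -[cE cn]; split=> // x; rewrite cE E.
Qed.

End Arrays.

(** * Truncated multiple zeta values and polylogarithms as nested sums *)

Section Bridge.
Context (R : realType) (F : finFieldType) (C : fieldType) (CI : Cinfty R F C).
Context (V : {fset npos}).

Local Notation q := #|F|.
Local Notation ev := (evt CI).
Local Notation vab := (vabs CI).
Local Notation znested := (nested (emb CI) (zeta_term CI (V := V))).
Local Notation wnested := (nested (emb CI) (weight_term CI (V := V))).

Lemma lt_vabs_poly (a b : {poly F}) : a != 0 -> b != 0 ->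
  (vab (ev a) < vab (ev b)) = ((size a).-1 < (size b).-1)%N.
Proof.
move=> a0 b0; rewrite !vabs_poly // ltr_eXn2l //.
by rewrite ltr1n q_gt1.
Qed.

Lemma chi_eval_set (Sg : {mset npos}%mset) a (t : {ffun V -> C}) :
  (forall x : V, (Sg (val x) <= 1)%N) ->
  chi CI Sg a t = eval_set CI (support_in V Sg) a t.
Proof.
move=> Sg1; rewrite /chi /eval_set [RHS]big_mkcond /=; apply: eq_bigr => x _.
by rewrite inE; have := Sg1 x; case: (Sg _) => [|[|]].
Qed.

Lemma zeta_truncE (c : array) (t : {ffun V -> C}) D :
  (forall x : V, (\sum_(b <- c) b.1 (val x) <= 1)%N) ->
  zeta_trunc CI c t D = array_sum (zeta_term CI (V := V)) c t D.
Proof.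
move=> c1; rewrite /zeta_trunc /array_sum.
transitivity (iter_sum [seq (fun d =>
    \sum_(a : {poly_D F} | (polyn a \is monic) && ((size (polyn a)).-1 == d))
      (chi CI b.1 (polyn a) t / ev (polyn a) ^+ val b.2)) | b <- c] D).
  rewrite -(@sum_decreasing _ _ _ (fun a : {poly_D F} => (size (polyn a)).-1)
    (fun a : {poly_D F} => polyn a \is monic) c
    (fun b a => chi CI b.1 (polyn a) t / ev (polyn a) ^+ val b.2)).
  apply: eq_bigl => a; case: (boolP [forall i, polyn (a i) \is monic]) => //= /forallP am.
  have -> : [forall i, ((size (polyn (a i))).-1 < D)%N].
    apply/forallP => i.
    by rewrite prednK ?size_poly_gt0 ?monic_neq0 ?size_npoly.
  rewrite andbT; apply: eq_forallb => i; apply: eq_forallb => j.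
  by rewrite lt_vabs_poly ?monic_neq0.
apply: eq_iter_sum => b d bc dD.
rewrite /zeta_term -(msumE (d := d) (D := D)) //.
apply: eq_big => [a|a _].
  case: (boolP (_ \is monic)) => //= /monic_neq0; rewrite -size_poly_gt0.
  by case: (size _).
rewrite chi_eval_set // => x; have := c1 x.
by rewrite (big_rem b) //=; apply: leq_trans; exact: leq_addr.
Qed.

Lemma unique_column (c : array) (x : V) : (\sum_(b <- c) b.1 (val x))%N = 1%N ->
  exists k0 : 'I_(size c),
    (forall f : 'I_(size c) -> nat,
       (\sum_(k < size c) (tnth (in_tuple c) k).1 (val x) * f k)%N = f k0) /\
    (forall k, (x \in support_in V (tnth (in_tuple c) k).1) = (k == k0)).
Proof.
rewrite big_tnth /= => c1.
have [k0 k0P] : exists k0 : 'I_(size c), (0 < (tnth (in_tuple c) k0).1 (val x))%N.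
  apply/existsP; apply: contraPT c1; rewrite negb_exists => /forallP c0.
  by rewrite big1 // => k _; apply/eqP; rewrite -leqn0 leqNgt.
move: c1; rewrite (bigD1 k0) //= => c1.
have one_split a b : (a + b = 1)%N -> (0 < a)%N -> a = 1%N /\ b = 0%N by lia.
have [k01 rest] := one_split _ _ c1 k0P.
have k0' k : k != k0 -> (tnth (in_tuple c) k).1 (val x) = 0%N.
  move=> kk; move/eqP: rest; rewrite sum_nat_eq0 => /forallP/(_ k).
  by rewrite kk => /eqP.
exists k0; split=> [f|k].
  by rewrite (bigD1 k0) //= k01 mul1n big1 ?addn0 // => k kk; rewrite k0'.
rewrite inE; case: eqVneq => [->|/k0' ->] //; by rewrite k01.
Qed.

Lemma natr_forall (P : pred V) : [forall x, P x]%:R = \prod_x (P x)%:R :> C.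
Proof.
case: (boolP [forall x, P x]) => [/forallP a|].
  by rewrite big1 // => x _; rewrite a.
rewrite negb_forall => /existsP [x /negPf xP].
by rewrite (bigD1 x) //= xP mul0r.
Qed.

(** The condition that the exponent be [q ^ i] says that the column of each variable
    [x] has degree [i x]: this is the product of the delta weights. *)
Lemma lambda_truncE (c : array) (i : V -> nat) (m : {ffun V -> nat}) D :
  (forall x : V, (\sum_(b <- c) b.1 (val x))%N = 1%N) ->
  (forall x, m x = (q ^ i x)%N) ->
  lambda_trunc CI c m D =
  array_sum (weight_term CI (V := V)) c (delta_weight C i) D.
Proof.
move=> c1 mi; rewrite /lambda_trunc /array_sum.
transitivity (iter_sum [seq (fun d =>
    \sum_(e : 'I_D | xpredT e && ((e : nat) == d))
      weight_term CI (delta_weight C i) e (support_in V b.1) (val b.2)) | b <- c] D);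
    last first.
  apply: eq_iter_sum => b d bc dD.
  by rewrite (big_pred1 (Ordinal dD)) // => e; rewrite /= -(inj_eq val_inj).
rewrite -(@sum_decreasing _ _ _ (fun e : 'I_D => val e) xpredT c
  (fun b e => weight_term CI (delta_weight C i) e (support_in V b.1) (val b.2))).
rewrite big_mkcondr /=; apply: eq_big => [d|d _].
  apply/idP/and3P => [dd|[] //]; split=> //; last first.
    by apply/forallP => k; exact: ltn_ord.
  by apply/(introT (fintype.forallP (P := fun _ : 'I_(size c) => true))).
rewrite big_split /= -mulrb -mulr_natr natr_forall; congr (_ * _).
rewrite [RHS](eq_bigr _ (fun k _ => big_mkcond _ _)) /= exchange_big /=.
apply: eq_bigr => x _; have [k0 [sumE suppE]] := unique_column (c1 x).
rewrite sumE mi eqn_exp2l ?q_gt1 // (bigD1 k0) //= suppE eqxx big1 ?mulr1 => [|k kk].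
  by rewrite /delta_weight eq_sym.
by rewrite suppE (negPf kk).
Qed.

Lemma lambda_trunc0 (c : array) (m : {ffun V -> nat}) D :
  (forall x : V, (\sum_(b <- c) b.1 (val x))%N = 1%N) ->
  ~~ [forall x, m x == (q ^ trunc_log q (m x))%N] ->
  lambda_trunc CI c m D = 0.
Proof.
move=> c1 mq; rewrite /lambda_trunc big_pred0 // => d.
apply: contraNF mq => /andP[_ /forallP md]; apply/forallP => x.
have [k0 [sumE _]] := unique_column (c1 x); move/eqP: (md x); rewrite sumE => ->.
by rewrite trunc_expnK ?q_gt1.
Qed.

Lemma admissible_column (c : array) n : admissible (indicator V) n c ->
  forall x : V, (\sum_(b <- c) b.1 (val x))%N = 1%N.
Proof. by case=> c1 _ x; rewrite c1 indicatorE (valP x). Qed.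

End Bridge.

(** * The graded modules and the isomorphism *)

Section Spaces.
Context (R : realType) (F : finFieldType) (C : fieldType) (CI : Cinfty R F C).
Context (V : {fset npos}).
Hypothesis Vq : (#|{: V}| < #|F|)%N.

Local Notation q := #|F|.
Local Notation vab := (vabs CI).
Local Notation znested := (nested (emb CI) (zeta_term CI (V := V))).
Local Notation wnested := (nested (emb CI) (weight_term CI (V := V))).
Implicit Types (f : functions C V) (t : {ffun V -> C}) (m : {ffun V -> nat}).

Lemma znested_cvg X n h (t : V -> C) : znested false X n h ->
  exists l, vcvg vab (h t) l.
Proof.
move=> nh; have [g ng hg] := znested_newton Vq nh.
have [l gl _] := wnested_cvg ng (null_newton_weight CI Vq t).
by exists l; apply: eq_vcvg gl => D; rewrite hg.
Qed.

Lemma zeta_cvg (c : array) (X : {set V}) n t : array_type c X n ->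
  vcvg vab (array_sum (zeta_term CI (V := V)) c t) (zeta CI c t).
Proof.
move=> [cX _]; have cX' (x : V) : (\sum_(b <- c) b.1 (val x))%N = (x \in X).
  by rewrite cX mset_ofE.
have [l cl] := znested_cvg t (array_nested (emb CI) (zeta_term CI (V := V)) cX').
have cE D : array_sum (zeta_term CI (V := V)) c t D = zeta_trunc CI c t D.
  by rewrite zeta_truncE // => x; rewrite cX' leq_b1.
have tl := eq_vcvg cE cl.
by rewrite /zeta (vcvg_lim tl).
Qed.

(** Linear combinations pass to the limit because the truncated multiple zeta values
    converge at every [t] ([znested_cvg]). *)
Lemma ZnP n f : Zn CI n f <->
  exists2 h, znested false [set: V] n h & forall t, vcvg vab (h t) (f t).
Proof.
split=> [[N [k [x [xZ ->]]]]|[h nh hf]].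
  have /choice [c cP] : forall i, exists c,
      admissible (indicator V) n c /\ x i = zeta CI (V := V) c.
    by move=> i; have [c ac xc] := xZ i; exists c.
  exists (fun (u : V -> C) D => \sum_(i < N) emb CI (k i) *
      array_sum (zeta_term CI (V := V)) (c i) u D).
    apply: nested_big => i _; apply: nestedZ.
    have [ac _] := cP i; have [_ cn] := ac; rewrite -cn; apply: array_nested => y.
    by rewrite (admissible_column ac) inE.
  move=> t; rewrite fct_sumE; apply: vcvg_sum => i _.
  have [/array_type_setT ac ->] := cP i.
  exact: vcvgM (vcvg_cst CI _) (zeta_cvg t ac).
have [s sP hE] := nested_arrays nh.
exists (size s), (fun i => (tnth (in_tuple s) i).1),
  (fun i => zeta CI (V := V) (tnth (in_tuple s) i).2).
have sP' i := sP _ (mem_tnth i (in_tuple s)).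
split=> [i|]; first by exists (tnth (in_tuple s) i).2 => //; apply/array_type_setT.
apply/funext => t; rewrite fct_sumE; apply: (vcvg_uniq (hf t)).
have cv : vcvg vab (fun D => \sum_(i < size s) emb CI (tnth (in_tuple s) i).1 *
      array_sum (zeta_term CI (V := V)) (tnth (in_tuple s) i).2 t D)
    (\sum_(i < size s) emb CI (tnth (in_tuple s) i).1 *
      zeta CI (tnth (in_tuple s) i).2 t).
  by apply: vcvg_sum => i _; exact: vcvgM (vcvg_cst CI _) (zeta_cvg t (sP' i)).
by apply: eq_vcvg cv => D; rewrite hE [RHS]big_tnth.
Qed.

Definition exponents m : V -> nat := fun x => trunc_log q (m x).

Definition is_qpower m := [forall x, m x == (q ^ exponents m x)%N].

Lemma lambda_cvg (c : array) n m : admissible (indicator V) n c -> is_qpower m ->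
  vcvg vab (array_sum (weight_term CI (V := V)) c (delta_weight C (exponents m)))
    (lambda CI c m).
Proof.
move=> ac /forallP mq; have c1 := admissible_column ac.
have cT x : (\sum_(b <- c) b.1 (val x))%N = (x \in [set: V]) by rewrite c1 inE.
have nc := array_nested (emb CI) (weight_term CI (V := V)) cT.
have [l cl _] := wnested_cvg nc (null_delta_weight CI (exponents m)).
have cE D : array_sum (weight_term CI (V := V)) c (delta_weight C (exponents m)) D
    = lambda_trunc CI c m D.
  by rewrite (lambda_truncE CI D c1 (i := exponents m)) // => x; apply/eqP.
by rewrite /lambda (vcvg_lim (eq_vcvg cE cl)).
Qed.

Lemma lambda_eq0 (c : array) n m : admissible (indicator V) n c -> ~~ is_qpower m ->
  lambda CI c m = 0.
Proof.
move=> ac mq; rewrite /lambda; apply: (vcvg_lim (CI := CI)).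
apply: eq_vcvg (vcvg_cst CI 0) => D.
by rewrite (lambda_trunc0 CI D (admissible_column ac)).
Qed.

Definition limit_coefficients (g : (V -> nat -> C) -> nat -> C)
    (p : Defs.pseries C V) : Prop :=
  forall m, if is_qpower m then vcvg vab (g (delta_weight C (exponents m))) (p m)
            else p m = 0.

Lemma LnP n (p : Defs.pseries C V) : Ln CI n p <->
  exists2 g, wnested false [set: V] n g & limit_coefficients g p.
Proof.
split=> [[N [k [x [xL ->]]]]|[g ng gp]].
  have /choice [c cP] : forall i, exists c,
      admissible (indicator V) n c /\ x i = lambda CI (V := V) c.
    by move=> i; have [c ac xc] := xL i; exists c.
  exists (fun w D => \sum_(i < N) emb CI (k i) *
      array_sum (weight_term CI (V := V)) (c i) w D).
    apply: nested_big => i _; apply: nestedZ.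
    have [ac _] := cP i; have [_ cn] := ac; rewrite -cn; apply: array_nested => y.
    by rewrite (admissible_column ac) inE.
  move=> m; rewrite fct_sumE; case: ifPn => mq.
    apply: vcvg_sum => i _; have [ac ->] := cP i.
    exact: vcvgM (vcvg_cst CI _) (lambda_cvg ac mq).
  rewrite big1 // => i _; have [ac ->] := cP i.
  transitivity (emb CI (k i) * lambda CI (c i) m); first by [].
  by rewrite (lambda_eq0 ac mq) mulr0.
have [s sP gE] := nested_arrays ng.
exists (size s), (fun i => (tnth (in_tuple s) i).1),
  (fun i => lambda CI (V := V) (tnth (in_tuple s) i).2).
have sP' i : admissible (indicator V) n (tnth (in_tuple s) i).2.
  by apply/array_type_setT; exact: sP _ (mem_tnth i (in_tuple s)).
split=> [i|]; first by exists (tnth (in_tuple s) i).2.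
apply/funext => m; rewrite fct_sumE; have := gp m; case: ifPn => mq; last first.
  move=> ->; rewrite big1 // => i _.
  transitivity (emb CI (tnth (in_tuple s) i).1 * lambda CI (tnth (in_tuple s) i).2 m).
    by [].
  by rewrite (lambda_eq0 (sP' i) mq) mulr0.
move=> /vcvg_uniq; apply.
have cv : vcvg vab (fun D => \sum_(i < size s) emb CI (tnth (in_tuple s) i).1 *
      array_sum (weight_term CI (V := V)) (tnth (in_tuple s) i).2
        (delta_weight C (exponents m)) D)
    (\sum_(i < size s) emb CI (tnth (in_tuple s) i).1 *
      lambda CI (tnth (in_tuple s) i).2 m).
  by apply: vcvg_sum => i _; exact: vcvgM (vcvg_cst CI _) (lambda_cvg (sP' i) mq).
by apply: eq_vcvg cv => D; rewrite gE [RHS]big_tnth.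
Qed.

(** Unlike [nested], this is closed under sums of elements of different weights. *)
Record represents (g : (V -> nat -> C) -> nat -> C) f : Prop := Represents {
  represents_multilinear : forall D, multilinear [set: V] D (g^~ D);
  represents_bound : exists2 M, 0 <= M & forall w, small_weight CI w ->
    forall d D, (d <= D)%N -> vab (g w D - g w d) <= M * ell CI d;
  represents_limit : forall t, vcvg vab (g (newton_weight CI t)) (f t)
}.

Lemma Zn_represents n f : Zn CI n f ->
  exists2 g, wnested false [set: V] n g & represents g f.
Proof.
move=> /ZnP [h nh hf]; have [g ng hg] := znested_newton Vq nh.
exists g => //; split=> [D||t].
- exact: wnested_multilinear ng D.
- have [M M0 gM] := wnested_bound ng; exists M => // w w1 d D dD.
  by have [_] := gM w w1 d; apply.
- by apply: eq_vcvg (hf t) => D; rewrite hg.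
Qed.

Lemma representsD g g' f f' : represents g f -> represents g' f' ->
  represents (fun w D => g w D + g' w D) (f + f').
Proof.
move=> [m1 [M1 M10 b1] l1] [m2 [M2 M20 b2] l2]; split=> [D||t].
- apply: multilinear_ext (multilinear_lin 1 (m1 D) (m2 D)) => w; by rewrite mul1r.
- exists (M1 + M2) => [|w w1 d D dD]; first exact: addr_ge0.
  have e0 := ell_ge0 CI d.
  rewrite opprD addrACA; apply: vabsD_le.
    by apply: le_trans (b1 w w1 d D dD) _; rewrite ler_wpM2r // lerDl.
  by apply: le_trans (b2 w w1 d D dD) _; rewrite ler_wpM2r // lerDr.
- exact: vcvgD (l1 t) (l2 t).
Qed.

Lemma representsN g f : represents g f -> represents (fun w D => - g w D) (- f).
Proof.
move=> [m1 [M1 M10 b1] l1]; split=> [D||t].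
- by apply: multilinear_ext (multilinearZ (-1) (m1 D)) => w; rewrite mulN1r.
- by exists M1 => // w w1 d D dD; rewrite -opprD vabsN b1.
- have := vcvgM (vcvg_cst CI (-1)) (l1 t); rewrite mulN1r.
  by apply: eq_vcvg => D; rewrite mulN1r.
Qed.

Lemma gsum_represents f : gsum (@Zn R F C CI V) f -> exists g, represents g f.
Proof.
move=> [N [x [xZ ->]]]; elim: N => [|N [g gx]].
  have [g _ gx] := Zn_represents (xZ 0%N).
  exists (fun w D => g w D + - g w D); rewrite big_ord0 -(subrr (x 0%N)).
  exact: representsD gx (representsN gx).
have [g' _ gx'] := Zn_represents (xZ N).
by exists (fun w D => g w D + g' w D); rewrite big_ord_recr; exact: representsD.
Qed.

(** By [divdiff_newton], the delta weight at [i] is the combination, with the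
    Lagrange weights, of the values of [newton_weight] at the nodes. *)
Lemma represents_coefF g f (i : {ffun V -> nat}) : represents g f ->
  vcvg vab (g (delta_weight C i)) (coefF CI f i).
Proof.
move=> [mg _ gf]; set N := (\max_(k : V) i k).+1.
have iN k : (i k < N)%N by rewrite ltnS; exact: leq_bigmax.
pose nodes (j : {ffun V -> 'I_N}) : {ffun V -> C} := [ffun k => node CI (j k)].
have gE D : g (delta_weight C i) D = \sum_(j : {ffun V -> 'I_N})
    (\prod_k lagrange_wt CI (i k) (j k)) * g (newton_weight CI (nodes j)) D.
  rewrite (@multilinear_expand C V D (g^~ D) N (fun k j => lagrange_wt CI (i k) j)
    (fun k j d => newton CI d (node CI j)) _ (mg D)).
    apply: eq_bigr => j _; congr (_ * g _ D).
    by apply/funext => k; apply/funext => d; rewrite /newton_weight ffunE.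
  move=> k d _; rewrite /delta_weight -(divdiff_newton CI (i k) d).
  rewrite (big_ord_widen_cond N xpredT
    (fun j => lagrange_wt CI (i k) j * newton CI d (node CI j))) //.
  rewrite big_mkcond; apply: eq_bigr => j _; case: ltnP => // ij.
  by rewrite /lagrange_wt leqNgt ij mul0r.
apply: eq_vcvg (fun D => esym (gE D)) _.
have -> : coefF CI f i = \sum_(j : {ffun V -> 'I_N})
    (\prod_k lagrange_wt CI (i k) (j k)) * f (nodes j).
  rewrite /coefF big_mkcond; apply: eq_bigr => j _; case: ifPn => [/forallP ji|].
    rewrite mulrC; congr (_ * _); apply: eq_bigr => k _.
    by rewrite lagrange_wtE.
  rewrite negb_forall => /existsP [k /negPf kj].
  by rewrite (bigD1 k) //= /lagrange_wt kj !mul0r.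
by apply: vcvg_sum => j _; exact: vcvgM (vcvg_cst CI _) (gf (nodes j)).
Qed.

Lemma mapFE f m : mapF CI f m =
  if is_qpower m then coefF CI f [ffun k => trunc_log q (m k)] else 0.
Proof.
have -> : is_qpower m =
    [forall k, m k == (q ^ [ffun k => trunc_log q (m k)] k)%N].
  by apply: eq_forallb => k; rewrite ffunE.
by [].
Qed.

Lemma mapF_limit_coefficients g f : represents g f -> limit_coefficients g (mapF CI f).
Proof.
move=> gf m; rewrite mapFE; case: (is_qpower m) => //.
have := represents_coefF [ffun k => trunc_log q (m k)] gf.
suff -> : delta_weight C [ffun k => trunc_log q (m k)] =
    delta_weight C (exponents m) by [].
by apply/funext => k; apply/funext => d; rewrite /delta_weight ffunE.
Qed.

Lemma mapFD f f' : mapF CI (f + f') = mapF CI f + mapF CI f'.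
Proof.
apply/funext => m; transitivity (mapF CI f m + mapF CI f' m); last by [].
rewrite !mapFE; case: ifP => _; last by rewrite addr0.
by rewrite /coefF -big_split; apply: eq_bigr => j _; exact: mulrDl.
Qed.

Lemma mapFZ a f : mapF CI (a *: f) = a *: mapF CI f.
Proof.
apply/funext => m; transitivity (a * mapF CI f m); last by [].
rewrite !mapFE; case: ifP => _; last by rewrite mulr0.
by rewrite /coefF mulr_sumr; apply: eq_bigr => j _; rewrite mulrA.
Qed.

(** A difference in the kernel has vanishing limits at all the delta weights, so
    that [newton_limit0] applies. *)
Lemma mapF_inj f f' : gsum (@Zn R F C CI V) f -> gsum (@Zn R F C CI V) f' ->
  mapF CI f = mapF CI f' -> f = f'.
Proof.
move=> /gsum_represents [g gf] /gsum_represents [g' gf'] ff'.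
have gff := representsD gf (representsN gf').
have ff0 : mapF CI (f - f') = 0.
  by rewrite mapFD -scaleN1r mapFZ scaleN1r ff' subrr.
apply/eqP; rewrite -subr_eq0; apply/eqP/funext => t.
have [mh [M M0 hM] lh] := gff.
apply: (newton_limit0 Vq mh M0 hM _ (lh t)) => i.
pose m : {ffun V -> nat} := [ffun k => (q ^ i k)%N].
have mi : exponents m = i.
  by apply/funext => k; rewrite /exponents ffunE trunc_expnK ?q_gt1.
have := mapF_limit_coefficients gff m; rewrite ff0 mi.
by rewrite (_ : is_qpower m) //; apply/forallP => k; rewrite mi ffunE.
Qed.

Lemma limit_coefficients_uniq g p p' : limit_coefficients g p ->
  limit_coefficients g p' -> p = p'.
Proof.
move=> gp gp'; apply/funext => m; have := gp m; have := gp' m.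
by case: ifP => _; [move=> a b; exact: vcvg_uniq b a | move=> -> ->].
Qed.

Lemma mapF_Zn n f : Zn CI n f -> Ln CI n (mapF CI f).
Proof.
move=> /Zn_represents [g ng gf]; apply/LnP; exists g => //.
exact: mapF_limit_coefficients.
Qed.

Lemma mapF_surj n (p : Defs.pseries C V) : Ln CI n p ->
  exists2 f, Zn CI n f & mapF CI f = p.
Proof.
move=> /LnP [g ng gp].
have /choice [f0 f0P] : forall t : {ffun V -> C},
    exists l, vcvg vab (g (newton_weight CI t)) l.
  move=> t; have [l gl _] := wnested_cvg ng (null_newton_weight CI Vq t).
  by exists l.
have fZ : Zn CI n (f0 : functions C V).
  apply/ZnP; exists (fun (u : V -> C) D => g (newton_weight CI u) D) => //.
  exact: wnested_newton.
exists f0 => //.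
apply: (limit_coefficients_uniq _ gp); apply: mapF_limit_coefficients.
split=> [D||//]; first exact: wnested_multilinear ng D.
have [M M0 gM] := wnested_bound ng; exists M => // w w1 d D dD.
by have [_] := gM w w1 d; apply.
Qed.

End Spaces.

Section Modules.
Context (R : realType) (F : finFieldType) (C : fieldType) (CI : Cinfty R F C).

Local Notation q := #|F|.
Local Notation vab := (vabs CI).

Lemma card_fset0 : (#|{: (fset0 : {fset npos})}| < q)%N.
Proof. by rewrite -cardfE cardfs0 (leq_trans _ (q_gt1 F)). Qed.

Lemma Zempty_nested (V : {fset npos}) n a : Zempty CI n a ->
  exists2 h, nested (emb CI) (zeta_term CI (V := V)) false finset.set0 n h &
    forall t, vcvg vab (h t) a.
Proof.
move=> [f /(ZnP CI card_fset0) [h nh hf] ->].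
have T0 : [set: (fset0 : {fset npos})] = finset.set0.
  by apply/setP => -[x xP]; exfalso; rewrite inE in xP.
rewrite T0 in nh; pose t0 : {ffun (fset0 : {fset npos}) -> C} := [ffun=> 0].
have S0 (t : V -> C) d l : zeta_term CI t d finset.set0 l =
    zeta_term CI t0 d finset.set0 l.
  by rewrite !zeta_term0.
exists (fun _ D => h t0 D); first exact: nested_set0 S0 nh.
by move=> t; exact: hf.
Qed.

Context (V : {fset npos}).
Hypothesis Vq : (#|{: V}| < q)%N.

Lemma Zn_graded_module : graded_module (Zempty CI) (@Zn R F C CI V).
Proof.
split=> [n|n x y /(ZnP CI Vq) [h nh hx] /(ZnP CI Vq) [h' nh' hy]
  |m n a x Za /(ZnP CI Vq) [h nh hx]].
- by apply/(ZnP CI Vq); exists (fun _ _ => 0); [exact: nested_0|move=> t; exact: vcvg_cst].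
- apply/(ZnP CI Vq); exists (fun t D => h t D - h' t D); first exact: nestedB.
  move=> t; have := vcvgD (hx t) (vcvgM (vcvg_cst CI (-1)) (hy t)).
  by rewrite mulN1r; apply: eq_vcvg => D; rewrite mulN1r.
have [h' nh' h'a] := Zempty_nested V Za.
have dT : [disjoint (@finset.set0 V) & [set: V]].
  by rewrite -finset.setI_eq0 finset.set0I.
apply/(ZnP CI Vq); exists (fun t D => h' t D * h t D).
  by have := znestedM dT nh' nh; rewrite finset.set0U.
by move=> t; exact: vcvgM (h'a t) (hx t).
Qed.

Lemma Ln_graded_module : graded_module (Zempty CI) (@Ln R F C CI V).
Proof.
split=> [n|n x y /(LnP CI) [g ng gx] /(LnP CI) [g' ng' gy]
  |m n a x Za /(LnP CI) [g ng gx]].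
- apply/(LnP CI); exists (fun _ _ => 0); first exact: nested_0.
  by move=> m; case: ifP => _ //; exact: vcvg_cst.
- apply/(LnP CI); exists (fun w D => g w D - g' w D); first exact: nestedB.
  move=> m; have := gx m; have := gy m; case: ifP => _ hy hx; last first.
    transitivity (x m - y m); first by [].
    by rewrite hx hy subr0.
  have := vcvgD hx (vcvgM (vcvg_cst CI (-1)) hy).
  by rewrite mulN1r; apply: eq_vcvg => D; rewrite mulN1r.
have [h' nh' h'a] := Zempty_nested V Za.
have dT : [disjoint (@finset.set0 V) & [set: V]].
  by rewrite -finset.setI_eq0 finset.set0I.
have S0 w d l : weight_term CI w d (@finset.set0 V) l =
    zeta_term CI (fun _ => 0) d (@finset.set0 V) l.
  by rewrite weight_term0 zeta_term0.
have ng' := nested_set0 S0 nh'.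
apply/(LnP CI); exists (fun w D => h' (fun _ => 0) D * g w D).
  by have := wnestedM dT ng' ng; rewrite finset.set0U.
move=> l; have := gx l; case: ifP => _ hx; last first.
  transitivity (a * x l); first by [].
  by rewrite hx mulr0.
exact: vcvgM (h'a _) hx.
Qed.

Lemma mapF_graded_iso :
  graded_iso (Zempty CI) (@Zn R F C CI V) (@Ln R F C CI V) (@mapF R F C CI V).
Proof.
have mapF0 : mapF CI (0 : functions C V) = 0.
  by have := mapFZ CI 0 (0 : functions C V); rewrite !scale0r.
have mapF_sum N (x : nat -> functions C V) :
    mapF CI (\sum_(n < N) x n) = \sum_(n < N) mapF CI (x n).
  exact: (big_morph (@mapF R F C CI V) (@mapFD R F C CI V) mapF0).
split=> [|x y _ _|a x _ _|n].
- split=> [f [N [x [xZ ->]]]|f f'|p [N [y [yL ->]]]].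
  + exists N, (fun n => mapF CI (x n)); split; last exact: mapF_sum.
    by move=> n; exact: mapF_Zn.
  + by move=> /set_mem Zf /set_mem Zf'; exact: mapF_inj.
  have /choice [x xP] : forall n, exists x, Zn CI n x /\ mapF CI x = y n.
    by move=> n; have [f Zf fy] := mapF_surj Vq (yL n); exists f.
  exists (\sum_(n < N) x n).
    by exists N, x; split=> // n; have [] := xP n.
  rewrite mapF_sum; apply: eq_bigr => n _; by have [] := xP n.
- exact: mapFD.
- exact: mapFZ.
apply/seteqP; split=> [_ [f Zf <-]|p Lp]; first exact: mapF_Zn.
by have [f Zf fp] := mapF_surj Vq Lp; exists f.
Qed.

End Modules.

Theorem theoremA (R : realType) (F : finFieldType) (C : fieldType)
    (CI : Cinfty R F C) (Sigma : {fset npos})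
    (hSigma : (#|` Sigma| < #|F|)%N) :
  [/\ graded_module (Zempty CI) (@Zn R F C CI Sigma),
      graded_module (Zempty CI) (@Ln R F C CI Sigma) &
      graded_iso (Zempty CI) (@Zn R F C CI Sigma) (@Ln R F C CI Sigma)
        (@mapF R F C CI Sigma)].
Proof.
rewrite cardfE in hSigma; split.
- exact: Zn_graded_module.
- exact: Ln_graded_module.
- exact: mapF_graded_iso.
Qed.
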